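(* Let $A$ be a unital semi-simple commutative Banach algebra, let $U$ be an automorphism of $A$ with induced homeomorphism $\varphi$ of $\mathfrak{M}_A$, and let $w \in A^{-1}$ (an invertible element of $A$). Let $T = wU$ on $A$ and let $\check{T}$ be the associated weighted composition operator on $\check{A}$, $(\check{T}g)(t) = \check{w}(t)g(\varphi(t))$. Assume that (i) $U^n \neq I$ for all $n \in \mathbb{N}$, and (ii) $\displaystyle\sum_{n=-\infty}^{\infty} \frac{|\ln \|(\check{T})^n\||}{1+n^2} < \infty$, where $\|\cdot\|$ is the operator norm on $\check{A}$. Then $\sigma(T) \supseteq \mathbb{T}$, where $\mathbb{T}$ is the unit circle.
   Context: $A$ is a unital commutative semi-simple Banach algebra with maximal ideal space $\mathfrak{M}_A$ and Shilov boundary $\partial A \subseteq \mathfrak{M}_A$. For $f \in A$, $\hat f \in C(\mathfrak{M}_A)$ is its Gelfand transform and $\check f = \hat f|_{\partial A}$; $\check{A}$ is the closure of $\{\check f : f \in A\}$ in $C(\partial A)$ with the sup norm. An automorphism $U$ of $A$ induces a homeomorphism $\varphi$ of $\mathfrak{M}_A$ onto itself via $F_{\varphi(m)} = U' F_m$ ($U'$ the Banach adjoint, $F_m$ the multiplicative functional of $m$), i.e. $\widehat{Uf}(m) = \hat f(\varphi(m))$; one has $\varphi(\partial A) = \partial A$. For $w \in A$, $T = wU$ is the operator $Tf = w\cdot Uf$ on $A$, and $\check T$ is the operator on $\check A$ given by $(\check{T}g)(t) = \check{w}(t)g(\varphi(t))$, $t \in \partial A$. Since $w$ is invertible, $\check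 T$ is invertible and negative powers make sense. $\sigma(\cdot)$ denotes the spectrum. *)

(* Defs.v *)
From HB Require Import structures.
From mathcomp Require Import all_boot all_order all_algebra.
From mathcomp Require Import all_classical all_reals all_analysis.
From mathcomp Require Import complex.
Set Implicit Arguments.
Unset Strict Implicit.
Unset Printing Implicit Defensive.
Import Order.TTheory GRing.Theory Num.Theory.
Import numFieldNormedType.Exports.
Local Open Scope classical_set_scope.
Local Open Scope ring_scope.

Section BanachDefs.
Variable R : realType.
Local Notation C := (complex R).

Definition cabs (z : C) : R := complex.Re `|z|.

Variable A : completeNormedModType C.
Variables (mul : A -> A -> A) (one : A).

Record is_comBanachAlg : Prop := {
  cba_mulA : forall x y z, mul x (mul y z) = mul (mul x y) z;
  cba_mulC : forall x y, mul x y = mul y x;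
  cba_mul1 : forall x, mul one x = x;
  cba_mulDl : forall x y z, mul (x + y) z = mul x z + mul y z;
  cba_mulZl : forall (a : C) x y, mul (a *: x) y = a *: mul x y;
  cba_normM : forall x y, `|mul x y| <= `|x| * `|y|;
  cba_one_neq0 : one != 0 }.

(* multiplicative linear functionals = points of the maximal ideal space;
   the Gelfand transform of f is  chi |-> chi f *)
Definition is_char (chi : A -> C) : Prop :=
  [/\ forall (a : C) x y, chi (a *: x + y) = a * chi x + chi y,
      forall x y, chi (mul x y) = chi x * chi y & chi one = 1].

Definition MA : set (A -> C) := [set chi | is_char chi].

(* semi-simplicity: the radical (= kernel of the Gelfand transform) is 0 *)
Definition semisimple : Prop :=
  forall f, (forall chi, is_char chi -> chi f = 0) -> f = 0.

(* closed sets of M_A for the Gelfand (weak-star) topology *)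
Definition gclosed (S : set (A -> C)) : Prop :=
  S `<=` MA /\
  forall chi, is_char chi -> ~ S chi ->
    exists (fs : seq A) (e : R), 0 < e /\
      forall psi, is_char psi ->
        (forall f, f \in fs -> cabs (psi f - chi f) < e) -> ~ S psi.

Definition is_boundary (B : set (A -> C)) : Prop :=
  B `<=` MA /\
  forall f, exists2 chi, B chi &
    forall psi, is_char psi -> cabs (psi f) <= cabs (chi f).

Definition shilov : set (A -> C) :=
  [set t | is_char t /\ forall B, gclosed B -> is_boundary B -> B t].

(* Gelfand transform restricted to the Shilov boundary *)
Definition gcheck (f : A) : (A -> C) -> C := fun t => t f.

(* A-check: the sup-norm closure of { f-check } in C(shilov);
   functions are only considered on the Shilov boundary *)
Definition Acheck : set ((A -> C) -> C) :=
  [set g | forall e : R, 0 < e ->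
     exists f : A, forall t, shilov t -> cabs (g t - gcheck f t) < e].

Definition supn (g : (A -> C) -> C) : \bar R :=
  ereal_sup [set (cabs (g t))%:E | t in shilov].

Variables (U Ui : A -> A) (w : A).

(* induced map on M_A: F_{phi(m)} = U' F_m, i.e. phi(chi) = chi o U *)
Definition phi (chi : A -> C) : A -> C := chi \o U.
Definition phiinv (chi : A -> C) : A -> C := chi \o Ui.

Definition Top (f : A) : A := mul w (U f).

Definition Tcheck (g : (A -> C) -> C) : (A -> C) -> C :=
  fun t => gcheck w t * g (phi t).
Definition Tcheckinv (g : (A -> C) -> C) : (A -> C) -> C :=
  fun t => g (phiinv t) / gcheck w (phiinv t).

Definition Tcheck_pow (n : int) : ((A -> C) -> C) -> ((A -> C) -> C) :=
  match n with
  | Posz k => iter k Tcheck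
  | Negz k => iter k.+1 Tcheckinv
  end.

Definition opnorm_Tcheck (n : int) : \bar R :=
  ereal_sup [set supn (Tcheck_pow n g) |
             g in [set g | Acheck g /\ (supn g <= 1)%E]].

End BanachDefs.

Definition spectrum (R : realType) (X : completeNormedModType (complex R))
    (T : X -> X) : set (complex R) :=
  [set lam | ~ exists S : X -> X,
      [/\ forall (a : complex R) x y, S (a *: x + y) = a *: S x + S y,
          continuous S,
          cancel (fun x => T x - lam *: x) S &
          cancel S (fun x => T x - lam *: x)]].

(* convergence of a two-sided series of nonnegative reals *)
Definition int_summable (R : realType) (a : int -> R) : Prop :=
  (\sum_(0 <= k <oo) (a (Posz k))%:E < +oo)%E /\
  (\sum_(0 <= k <oo) (a (Negz k))%:E < +oo)%E.

(* Main.v *)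
Require Import Defs.
From HB Require Import structures.
From mathcomp Require Import all_boot all_order all_algebra.
From mathcomp Require Import all_classical all_reals all_analysis.
From mathcomp Require Import complex.
From mathcomp Require Import ring lra zify.
Import Order.TTheory GRing.Theory Num.Theory.
Import numFieldNormedType.Exports.
Local Open Scope classical_set_scope.
Local Open Scope ring_scope.

(** Suppose [S] inverts [T - lam] with [|lam| = 1] and [|S x| <= M |x|]. For a
    character [t], the sequences [b k n = t (T^n (S^k f))] satisfy
    [b k n = b k.+1 (n + 1) - lam * b k.+1 n] and [|b k n| <= M^k |f| rho n],
    where [rho n], the norm of the [n]-th power of T-check, is the supremum of
    [|t (T^n 1)|] over the Shilov boundary. So, after the twist by powers of
    [lam], [b 0] is a [k]-th difference for every [k], with a bound that grows
    only like [M^k].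

    By (ii), the Beurling condition, there are products [g] of cardinal sines
    with [g 0 = 1] and with [|g n| rho n] summable, all of whose [k]-th
    differences are at most [H^k] times a summable weight, with [H M] as small
    as we like. Summation by parts, applied [k] times, then makes
    [sum_n g n * b 0 n] vanish.

    By (i) there are points [t] of the Shilov boundary whose iterates
    [t, ..., phi^N t] are distinct, for [N] arbitrarily large; a function [f]
    peaking at such a point makes [b 0] close to the Dirac sequence at [0],
    and the sum cannot vanish. *)

Set Implicit Arguments.
Unset Strict Implicit.
Unset Printing Implicit Defensive.

(** * Finite differences and the cardinal sine *)

Section Differences.
Variable R : realType.
Implicit Types (u v g : int -> R) (m k : nat) (n : int).

Definition dif g : int -> R := fun n => g n - g (n - 1).

Lemma iter_difD m u v n :
  iter m dif (fun n => u n + v n) n = iter m dif u n + iter m dif v n.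
Proof.
elim: m n => //= m IH n.
by rewrite /dif !IH; ring.
Qed.

Lemma iter_difZ m (a : R) u n :
  iter m dif (fun n => a * u n) n = a * iter m dif u n.
Proof. by elim: m n => //= m IH n; rewrite /dif !IH; ring. Qed.

Lemma iter_dif_shift m u n : iter m dif (fun n => u (n - 1)) n = iter m dif u (n - 1).
Proof. by elim: m n => //= m IH n; rewrite /dif !IH. Qed.

Lemma eq_iter_dif m u v : u =1 v -> iter m dif u =1 iter m dif v.
Proof. by move=> /funext ->. Qed.

Lemma dif_mul u v n :
  dif (fun n => u n * v n) n = dif u n * v n + u (n - 1) * dif v n.
Proof. by rewrite /dif; ring. Qed.

(** Discrete Leibniz rule: each difference falls on one factor and may shift the other, and the
    binomial expansion sums to [(Hu + Hv) ^+ m]. The condition [i + j <= m] keeps all points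
    involved within [n - m .. n]. *)
Lemma iter_dif_mul_bound m u v (Hu Hv Ku Kv : R) n :
  0 <= Hu -> 0 <= Hv -> 0 <= Ku -> 0 <= Kv ->
  (forall i j, (i + j <= m)%N -> `|iter i dif u (n - j%:Z)| <= Hu ^+ i * Ku) ->
  (forall i j, (i + j <= m)%N -> `|iter i dif v (n - j%:Z)| <= Hv ^+ i * Kv) ->
  `|iter m dif (fun n => u n * v n) n| <= (Hu + Hv) ^+ m * (Ku * Kv).
Proof.
move=> Hu0 Hv0; elim: m u v Ku Kv => [|m IH] u v Ku Kv Ku0 Kv0 hu hv.
  have := hu 0%N 0%N isT; have := hv 0%N 0%N isT.
  rewrite /= subr0 !expr0 !mul1r normrM => h1 h2.
  by apply: ler_pM.
rewrite iterSr.
have -> : dif (fun n => u n * v n) =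
  fun n => dif u n * v n + u (n - 1) * dif v n.
  by apply/funext => k; rewrite dif_mul.
rewrite iter_difD (le_trans (ler_normD _ _))//.
have -> : (Hu + Hv) ^+ m.+1 * (Ku * Kv) = (Hu + Hv) ^+ m * ((Hu * Ku) * Kv) +
  (Hu + Hv) ^+ m * (Ku * (Hv * Kv)) by rewrite exprS; ring.
apply: lerD.
  apply: IH => //; first exact: mulr_ge0.
  - move=> i j ij; rewrite -iterSr.
    by rewrite mulrA -exprSr; apply: hu; rewrite addSn.
  - by move=> i j ij; apply: hv; rewrite (leq_trans ij).
apply: IH => //; first exact: mulr_ge0.
- move=> i j ij; rewrite iter_dif_shift.
  have -> : n - j%:Z - 1 = n - j.+1%:Z by lia.
  by apply: hu; rewrite addnS.
- move=> i j ij; rewrite -iterSr.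
  by rewrite mulrA -exprSr; apply: hv; rewrite addSn.
Qed.

(* The discrete form of "[g] has exponential type [H] and is majorised by [G]":
   [D] bounds from below the distance from [0] to the points [n - m .. n]
   which enter the [m]-th difference at [n]. *)
Definition type_bound (H : R) (G : nat -> R) g := forall m n (D : nat),
  (forall i, (i <= m)%N -> (D <= absz (n - i%:Z)%R)%N) ->
  `|iter m dif g n| <= H ^+ m * G D.

Lemma type_boundM (H1 H2 : R) (G1 G2 : nat -> R) g1 g2 : 0 <= H1 -> 0 <= H2 ->
  (forall D, 0 <= G1 D) -> (forall D, 0 <= G2 D) ->
  type_bound H1 G1 g1 -> type_bound H2 G2 g2 ->
  type_bound (H1 + H2) (fun D => G1 D * G2 D) (fun n => g1 n * g2 n).
Proof.
move=> H10 H20 G10 G20 b1 b2 m n D hD.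
have hD' i j : (i + j <= m)%N -> forall k, (k <= i)%N -> (D <= absz (n - j%:Z - k%:Z)%R)%N.
  move=> ij k ki; have -> : n - j%:Z - k%:Z = n - (j + k)%N%:Z by lia.
  by apply: hD; rewrite (leq_trans _ ij)// addnC leq_add2r.
by apply: iter_dif_mul_bound => // i j ij; [apply: b1|apply: b2]; exact: hD'.
Qed.

Lemma type_bound1 : type_bound 0 (fun=> 1) (fun=> 1).
Proof.
move=> [|m] n D _; first by rewrite /= normr1 expr0 mulr1.
rewrite iterSr (_ : dif _ = fun=> 0 * 0); last first.
  by apply/funext => k; rewrite /dif subrr mulr0.
by rewrite iter_difZ mul0r normr0 mulr_ge0.
Qed.

Lemma type_boundX (H : R) (G : nat -> R) g p : 0 <= H -> (forall D, 0 <= G D) ->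
  type_bound H G g ->
  type_bound (p%:R * H) (fun D => G D ^+ p) (fun n => g n ^+ p).
Proof.
move=> H0 G0 b; elim: p => [|p IH].
  have := type_bound1; rewrite mul0r.
  by congr (type_bound _ _ _); apply/funext => n; rewrite expr0.
have -> : p.+1%:R * H = H + p%:R * H by rewrite -natr1; ring.
have -> : (fun D => G D ^+ p.+1) = (fun D => G D * G D ^+ p).
  by apply/funext => D; rewrite exprS.
have -> : (fun n => g n ^+ p.+1) = (fun n => g n * g n ^+ p).
  by apply/funext => D; rewrite exprS.
apply: type_boundM => //; first by rewrite mulr_ge0.
by move=> D; rewrite exprn_ge0.
Qed.

Lemma abs_sin_le (x : R) : 0 <= x -> `|sin x| <= x.
Proof.
move=> x0.
have [|c _] := @MVT_segment R sin cos 0 x x0.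
- by apply: continuous_subspaceT => y; exact: continuous_sin.
- rewrite sin0 !subr0 => ->; rewrite normrM (ger0_norm x0).
  by rewrite ler_piMl// ler_norml cos_geN1 cos_le1.
Qed.

(** A difference of a cosine is again a cosine with the same frequency: the amplitude gains
    [2 * sin (th / 2)] and only the phase moves. *)
Lemma iter_dif_cos m (th al : R) : exists al', forall n,
  iter m dif (fun n => cos (th * n%:~R + al)) n =
  (2 * sin (th / 2)) ^+ m * cos (th * n%:~R + al').
Proof.
elim: m => [|m [al' IH]]; first by exists al => n; rewrite expr0 mul1r.
exists (al' - th / 2 + pi / 2) => n; rewrite iterS.
rewrite (_ : iter m _ _ = fun n => (2 * sin (th / 2)) ^+ m * cos (th * n%:~R + al')); last first.
  exact/funext.
rewrite /dif -mulrBr exprSr -mulrA; congr (_ * _).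
rewrite addrA cosDpihalf.
set a := th * n%:~R + (al' - th / 2).
have -> : th * n%:~R + al' = a + th / 2 by rewrite /a; ring.
have -> : th * (n - 1)%:~R + al' = a - th / 2.
  by rewrite /a rmorphB/= rmorph1; field.
by rewrite cosB cosD; ring.
Qed.

Lemma iter_dif_cos_le m (th al : R) n : 0 <= th ->
  `|iter m dif (fun n => cos (th * n%:~R + al)) n| <= th ^+ m.
Proof.
move=> th0; have [al' ->] := iter_dif_cos m th al.
rewrite normrM normrX.
have h1 : `|cos (th * n%:~R + al')| <= 1 by rewrite ler_norml cos_geN1 cos_le1.
apply: le_trans (ler_wpM2l _ h1) _; first by rewrite exprn_ge0.
rewrite mulr1 lerXn2r ?nnegrE//.
rewrite normrM ger0_norm//.
by have := @abs_sin_le (th / 2); rewrite divr_ge0// => /(_ isT); lra.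
Qed.

Definition sinc (h : R) n : R :=
  if n == 0 then 1 else sin (h * n%:~R) / (h * n%:~R).

(* [s * sinc (s h) n], whose derivative in [s] is [cos (s h n)]. *)
Let primc (h s : R) n : R :=
  if n == 0 then s else sin (s * (h * n%:~R)) / (h * n%:~R).

Let is_derive_primc m (h : R) n (s : R) : h != 0 -> is_derive s 1
  (fun s => iter m dif (primc h s) n)
  (iter m dif (fun n => cos (s * h * n%:~R + 0)) n).
Proof.
move=> h0; elim: m n => [|m IH] n; last first.
  exact: (@is_deriveB _ _ _ (fun s => iter m dif (primc h s) n)
    (fun s => iter m dif (primc h s) (n - 1)) _ _ _ _ (IH _) (IH _)).
rewrite /= /primc addr0.
have [->|n0] := eqVneq n 0; first by rewrite mulr0 cos0; exact: is_derive_id.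
have hn0 : h * n%:~R != 0 by rewrite mulf_neq0// intr_eq0.
set c := h * _ in hn0 *; rewrite -mulrA -/c.
rewrite (_ : (fun _ => _) = c^-1 \*: (@sin R \o (fun s => s * c))); last first.
  by apply/funext => x /=; rewrite mulrC.
apply: is_derive_eq.
by rewrite /GRing.scale/= mulr0 add0r mulr1 mulrC -mulrA mulrV ?unitfE ?mulr1//.
Qed.

(** Integration of the bound over [[0, 1]], carried out by the mean value theorem for
    [G s - a / m.+1%:R * s ^+ m.+1]. *)
Lemma derive_abs_le (F F' : R -> R) (a : R) m :
  (forall s : R, is_derive s 1 F (F' s)) -> F 0 = 0 ->
  (forall s, 0 <= s -> `|F' s| <= a * s ^+ m) -> `|F 1| <= a / m.+1%:R.
Proof.
move=> dF F0 bF.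
suff key (G G' : R -> R) : (forall s : R, is_derive s 1 G (G' s)) -> G 0 = 0 ->
    (forall s, 0 <= s -> G' s <= a * s ^+ m) -> G 1 <= a / m.+1%:R.
  rewrite ler_norml; apply/andP; split; last first.
    by apply: (key _ _ dF F0) => s /bF; rewrite ler_norml => /andP[].
  rewrite lerNl; apply: (key (\- F) (fun s => - F' s)).
  - by rewrite /= F0 oppr0.
  - by move=> s /bF; rewrite ler_norml lerNl => /andP[].
move=> dG G0 bG.
pose K s := G s - a / m.+1%:R * s ^+ m.+1.
have dK (s : R) : is_derive s 1 K (G' s - a * s ^+ m).
  rewrite /K.
  have d1 : is_derive s 1 (fun s : R => a / m.+1%:R * s ^+ m.+1) (a * s ^+ m).
    have d0 := is_deriveZ (a / m.+1%:R) (is_deriveX m.+1 (is_derive_id s 1)).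
    rewrite (_ : (fun _ => _) = (a / m.+1%:R) \*: ((id : R -> R) ^+ m.+1)); last first.
      by apply/funext => x; rewrite exprfctE.
    apply: is_derive_eq.
    have ? : m.+1%:R != 0 :> R by [].
    by rewrite /GRing.scale/= mulr1; field.
  exact: (is_deriveB (dG s) d1).
have [|c /andP[c0 _]] := @MVT_segment R K (fun s => G' s - a * s ^+ m) 0 1 ler01 (fun s _ => dK s).
  apply: continuous_subspaceT => y; apply: differentiable_continuous.
  by apply/derivable1_diffP; case: (dK y).
rewrite /K G0 expr0n expr1n/= mulr0 mulr1 !subr0 mulr1 => h.
have c0' : 0 <= c by move: c0; rewrite bnd_simp.
by rewrite -subr_le0 h subr_le0 bG.
Qed.

(** The cardinal sine is the mean of [cos (s * h * n)] over [s] in [[0, 1]], and the differences of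
    the latter are at most [(s * h) ^+ m]. *)
Lemma iter_dif_sinc_le m (h : R) n : 0 < h ->
  `|iter m dif (sinc h) n| <= h ^+ m / m.+1%:R.
Proof.
move=> h0.
have -> : iter m dif (sinc h) n = iter m dif (primc h 1) n.
  by apply: eq_iter_dif => k; rewrite /sinc /primc mul1r.
apply: (@derive_abs_le (fun s => iter m dif (primc h s) n)
  (fun s => iter m dif (fun n => cos (s * h * n%:~R + 0)) n)).
- by move=> s; apply: is_derive_primc; rewrite gt_eqF.
- rewrite (@eq_iter_dif m _ (fun k : int => 0 * primc h 0 k)) ?iter_difZ ?mul0r// => k.
  by rewrite /primc !mul0r sin0; case: ifP => // _; rewrite mul0r.
- move=> s s0; apply: le_trans (iter_dif_cos_le _ _ _ _) _.
    by rewrite mulr_ge0// ltW.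
  by rewrite exprMn mulrC.
Qed.

Lemma iter_dif_mulid m u n :
  iter m dif (fun n => n%:~R * u n) n =
  n%:~R * iter m dif u n + m%:R * iter m.-1 dif u (n - 1).
Proof.
elim: m n => [|[|m] IH] n; first by rewrite /= mul0r addr0.
  by rewrite /= /dif rmorphB/= rmorph1; ring.
rewrite iterS {1}/dif !IH /= /dif rmorphB/= rmorph1 -[m.+2%:R]natr1.
by ring.
Qed.

(* [n * sinc h n = sin (h n) / h], and multiplication by [n] commutes with
   differences up to a difference of lower order. *)
Lemma iter_dif_sinc_decay m (h : R) n : 0 < h ->
  `|n%:~R| * `|iter m dif (sinc h) n| <= h ^+ m * (2 / h).
Proof.
move=> h0; have hN0 : h != 0 by rewrite gt_eqF.
have E : (fun n => n%:~R * sinc h n) =1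
    (fun n => h^-1 * cos (h * n%:~R + (- (pi / 2)))).
  move=> k; rewrite /sinc.
  have -> : cos (h * k%:~R - pi / 2) = sin (h * k%:~R) :> R.
    by rewrite cosB cos_pihalf sin_pihalf mulr0 mulr1 add0r.
  have [->|k0] := eqVneq k 0; first by rewrite mulr0 sin0 mul0r mulr0.
  by have ? : k%:~R != 0 :> R by [rewrite intr_eq0]; field; rewrite hN0.
have := iter_dif_mulid m (sinc h) n.
rewrite (eq_iter_dif m E) iter_difZ => F.
rewrite -normrM (_ : n%:~R * _ = h^-1 * iter m dif
  (fun n0 : int => cos (h * n0%:~R + - (pi / 2))) n
  - m%:R * iter m.-1 dif (sinc h) (n - 1)); last by rewrite F addrK.
have -> : h ^+ m * (2 / h) = h^-1 * h ^+ m + h ^+ m / h by field.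
rewrite (le_trans (ler_normB _ _))// lerD//.
  rewrite normrM gtr0_norm ?invr_gt0// ler_pM2l ?invr_gt0//.
  by apply: iter_dif_cos_le; exact: ltW.
case: m F => [|m] F; first by rewrite mul0r normr0 divr_ge0 ?exprn_ge0// ltW.
rewrite normrM normr_nat exprSr mulfK//=.
by rewrite mulrC -ler_pdivlMr// iter_dif_sinc_le.
Qed.

(* The test keeps the junk value [2 / 0 = 0] out of the case [D = 0]. *)
Definition sinc_major (h : R) (D : nat) : R :=
  if h * D%:R <= 2 then 1 else 2 / (h * D%:R).

Lemma sinc_major_ge0 (h : R) D : 0 < h -> 0 <= sinc_major h D.
Proof.
by move=> h0; rewrite /sinc_major; case: ifP => // _; rewrite divr_ge0// mulr_ge0// ltW.
Qed.

Lemma sinc_major_le1 (h : R) D : sinc_major h D <= 1.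
Proof.
rewrite /sinc_major; case: (leP (h * D%:R) 2) => [_|hD]; first exact: lexx.
by rewrite ler_pdivrMr ?mul1r ?(ltW hD)// (lt_trans _ hD).
Qed.

Lemma type_bound_sinc (h : R) : 0 < h -> type_bound h (sinc_major h) (sinc h).
Proof.
move=> h0 m n D hD; rewrite /sinc_major; case: (leP (h * D%:R) 2) => hD2.
  rewrite mulr1 (le_trans (iter_dif_sinc_le _ _ h0))//.
  by rewrite ler_pdivrMr// ler_peMr ?ler1n// exprn_ge0// ltW.
have D0 : 0 < D%:R :> R by rewrite -(pmulr_rgt0 _ h0) (lt_trans _ hD2).
have -> : h ^+ m * (2 / (h * D%:R)) = h ^+ m * (2 / h) / D%:R.
  by field; rewrite !gt_eqF.
rewrite ler_pdivlMr// mulrC (le_trans _ (iter_dif_sinc_decay m n h0))//.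
rewrite ler_wpM2r// -intr_norm -abszE -pmulrn ler_nat.
by have := hD 0%N isT; rewrite subr0.
Qed.
End Differences.
Arguments dif {R} g n.

(** * Multipliers for a Beurling weight *)

Section Multiplier.
Variable R : realType.

Lemma bounded_sums_tail (a : nat -> R) (s e : R) : (forall i, 0 <= a i) ->
  (forall I, \sum_(0 <= i < I) a i <= s) -> 0 < e ->
  exists i0, forall J, \sum_(i0 <= i < J) a i <= e.
Proof.
move=> a0 hs e0.
pose S := [set \sum_(0 <= i < I) a i | I in [set: nat]].
have hS : has_sup S.
  split; first by exists (\sum_(0 <= i < 0) a i); exists 0%N.
  by exists s => _ [I _ <-]; exact: hs.
have [_ [i0 _ <-] h] := sup_adherent e0 hS.
exists i0 => J; have [Ji|iJ] := leqP J i0; first by rewrite big_geq// ltW.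
have : \sum_(0 <= i < J) a i <= sup S by apply: sup_upper_bound => //; exists J.
by rewrite (big_cat_nat (n := i0))//=; [lra|exact: ltnW].
Qed.

(* Averaging [Ga n <= Ga y + Ga (n - y)] over [y] bounds [Ga] on the block
   [2^i .. 2^i.+1] by twice its mean on [0 .. 2^i.+1]. *)
Lemma subadditive_dyadic (Ga : nat -> R) (s : R) :
  (forall n, 0 <= Ga n) -> (forall m n, Ga (m + n)%N <= Ga m + Ga n) ->
  (forall N, \sum_(0 <= n < N) Ga n / (1 + n%:R ^+ 2) <= s) ->
  exists B : nat -> R, [/\ forall i, 0 <= B i,
    forall i n, (2 ^ i <= n < 2 ^ i.+1)%N -> Ga n <= B i &
    forall I, \sum_(0 <= i < I) B i / 2 ^+ i <= 40 * s].
Proof.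
move=> Ga0 GaD hs.
pose S i := \sum_(0 <= y < 2 ^ i.+1) Ga y.
pose t N := \sum_(0 <= n < N) Ga n / (1 + n%:R ^+ 2).
have S0 i : 0 <= S i by apply: sumr_ge0.
have p2 i : 0 < 2 ^+ i :> R by rewrite exprn_gt0.
exists (fun i => 2 * S i / 2 ^+ i); split.
- by move=> i; rewrite divr_ge0 ?mulr_ge0// ltW.
- move=> i n /andP[in1 in2].
  rewrite ler_pdivlMr//.
  have h1 : n.+1%:R * Ga n <= \sum_(0 <= y < n.+1) (Ga y + Ga (n - y)%N).
    rewrite [leLHS](_ : _ = \sum_(0 <= y < n.+1) Ga n); last first.
      by rewrite sumr_const_nat subn0 mulr_natl.
    apply: ler_sum_nat => y /andP[_ yn].
    by rewrite -{1}(subnKC (n := n) (m := y)).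
  rewrite big_split/= in h1.
  have h2 : \sum_(0 <= y < n.+1) Ga (n - y)%N = \sum_(0 <= y < n.+1) Ga y.
    rewrite [RHS]big_nat_rev/=; apply: eq_big_nat => y /andP[_ yn].
    by rewrite add0n subSS.
  rewrite h2 in h1.
  have h3 : \sum_(0 <= y < n.+1) Ga y <= S i.
    rewrite /S [leRHS](big_cat_nat (n := n.+1))//= lerDl; exact: sumr_ge0.
  have h4 : 2 ^+ i <= n.+1%:R :> R by rewrite -natrX ler_nat (leq_trans in1).
  have h5 : Ga n * 2 ^+ i <= n.+1%:R * Ga n by rewrite mulrC ler_wpM2r.
  by move: h1 h3 h5; lra.
- pose Q i := S i / 4 ^+ i.
  have p4 i : 0 < 4 ^+ i :> R by rewrite exprn_gt0.
  have Q0 i : 0 <= Q i by rewrite divr_ge0// ltW.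
  (* Since [Q I.+1] is [Q I / 4] plus the new block over [4 ^+ I.+1], the correction [Q I / 3] lets
     the induction close: a block adds exactly 4/3 of that quotient. On the block
     [1 + y^2 <= 5 * 4 ^+ I.+1], whence the constant 20/3. *)
  have key I : \sum_(0 <= i < I.+1) Q i + Q I / 3 <= 20 / 3 * t (2 ^ I.+1)%N.
    elim: I => [|I IH].
      rewrite big_nat1 /Q /S /t /= expr0 divr1 expn1.
      rewrite !(big_nat_recl 1)//= !big_nat1 expr0n/= addr0 divr1 expr1n.
      rewrite (_ : 1 + 1 = 2 :> R); last by ring.
      by have := Ga0 0%N; have := Ga0 1%N; lra.
    rewrite big_nat_recr//=.
    have tI : t (2 ^ I.+2)%N = t (2 ^ I.+1)%N +
        \sum_(2 ^ I.+1 <= y < 2 ^ I.+2) Ga y / (1 + y%:R ^+ 2).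
      by rewrite /t (big_cat_nat (n := (2 ^ I.+1)%N))//= leq_exp2l.
    have SI : S I.+1 = S I + \sum_(2 ^ I.+1 <= y < 2 ^ I.+2) Ga y.
      by rewrite /S (big_cat_nat (n := (2 ^ I.+1)%N))//= leq_exp2l.
    have h : (\sum_(2 ^ I.+1 <= y < 2 ^ I.+2) Ga y) / 4 ^+ I.+1 <=
        5 * \sum_(2 ^ I.+1 <= y < 2 ^ I.+2) Ga y / (1 + y%:R ^+ 2).
      rewrite mulr_suml mulr_sumr; apply: ler_sum_nat => y /andP[_ y2].
      rewrite ler_pdivrMr// (_ : 5 * _ * _ =
        Ga y * ((5 * 4 ^+ I.+1) / (1 + y%:R ^+ 2))); last by ring.
      rewrite ler_peMr// ler_pdivlMr ?mul1r; last by rewrite ltr_pwDl// sqr_ge0.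
      have : y%:R ^+ 2 <= (2 ^+ I.+2) ^+ 2 :> R.
        rewrite lerXn2r ?nnegrE ?ler0n ?exprn_ge0//.
        by rewrite -natrX ler_nat ltnW.
      have -> : (2 ^+ I.+2) ^+ 2 = 4 * 4 ^+ I.+1 :> R.
        by rewrite -exprM mulnC exprM (_ : 2 ^+ 2 = 4) ?exprS//; ring.
      have : 1 <= 4 ^+ I.+1 :> R by rewrite exprn_ege1// ler1n.
      by lra.
    have QI : Q I.+1 = Q I / 4 + (\sum_(2 ^ I.+1 <= y < 2 ^ I.+2) Ga y) / 4 ^+ I.+1.
      rewrite /Q SI mulrDl; congr (_ + _).
      by rewrite exprS; field; rewrite gt_eqF.
    by move: IH h; rewrite tI QI; lra.
  move=> [|I].
    rewrite big_geq//; have := hs 0%N; rewrite big_geq//; lra.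
  have h := key I; have h2 := hs (2 ^ I.+1)%N.
  rewrite (_ : \sum_(_ <= _ < _) _ = 2 * \sum_(0 <= i < I.+1) Q i); last first.
    rewrite mulr_sumr; apply: eq_big_nat => i _.
    rewrite /Q (_ : 4 = 2 * 2) ?exprMn; last by ring.
    by field; rewrite gt_eqF.
  have := Q0 I; rewrite -/(t _) in h2.
  have := hs 0%N; rewrite big_geq//; move: h h2; lra.
Qed.

Lemma sum_affine_dyadic I :
  \sum_(0 <= i < I) (2 * i%:R + 4) / 2 ^+ i = 12 - (4 * I%:R + 12) / 2 ^+ I :> R.
Proof.
elim: I => [|I IH]; first by rewrite big_geq// expr0; field.
rewrite big_nat_recr//= IH exprS -natr1; field.
by rewrite expf_neq0.
Qed.

(* [p i] copies of [sinc (r i)] with [r i = 2 e / 2^i] contribute the factor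
   [expR (- p i)] on [2^i .. 2^i.+1], at the price [p i * r i] in the type; the
   price is affordable because of the summability, if one starts at a late [i0]. *)
Lemma exists_multiplier (Om : nat -> R) (s e : R) :
  (forall n, 1 <= Om n) -> (forall m n, Om (m + n)%N <= Om m * Om n) ->
  (forall N, \sum_(0 <= n < N) ln (Om n) / (1 + n%:R ^+ 2) <= s) -> 0 < e ->
  exists2 K, 0 < K & forall J, exists g G H, [/\ 0 <= H <= e,
    type_bound H G g, g 0 = 1, forall D, 0 <= G D &
    forall m, (m < 2 ^ J)%N -> G m * Om m <= K / (m.+1%:R * m.+2%:R)].
Proof.
move=> Om1 OmM hs e0.
have Om0 n : 0 < Om n by rewrite (lt_le_trans _ (Om1 n)).
have [|m n|B [B0 BGa sB]] := @subadditive_dyadic (fun n => ln (Om n)) s _ _ hs.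
- by move=> n; rewrite ln_ge0.
- by rewrite -lnM ?posrE// ler_ln ?posrE ?mulr_gt0.
pose E1 : R := expR 1.
have E10 : 0 < E1 by exact: expR_gt0.
(* With [p i >= B i + 2 i + 3], the factor [expR (- p i)] beats both [Om m <= expR (B i)] and
   [(m + 1)(m + 2) <= expR (2 i + 3)] on the [i]-th block. *)
pose p i := ((Num.truncn (B i)).+1 + (2 * i + 3))%N.
pose r i : R := 2 * E1 / 2 ^+ i.
have p2 i : 0 < 2 ^+ i :> R by rewrite exprn_gt0.
have r0 i : 0 < r i by rewrite divr_gt0// mulr_gt0.
have pB i : B i + (2 * i%:R + 3) <= (p i)%:R <= B i + (2 * i%:R + 4).
  rewrite /p natrD -natr1 natrD natrM.
  have /andP[h1 h2] := truncn_itv (B0 i).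
  by move: h2; rewrite -natr1; move: h1; lra.
have [i0 hi0] : exists i0, forall J, \sum_(i0 <= i < J) (p i)%:R * r i <= e.
  apply: (@bounded_sums_tail _ (2 * E1 * (40 * s + 12))) => //.
    by move=> i; rewrite mulr_ge0// ltW.
  move=> I.
  apply: (@le_trans _ _ (2 * E1 * (\sum_(0 <= i < I) B i / 2 ^+ i +
     \sum_(0 <= i < I) (2 * i%:R + 4) / 2 ^+ i))).
    rewrite -big_split/= mulr_sumr; apply: ler_sum => i _.
    have /andP[_ h] := pB i.
    rewrite /r (_ : 2 * E1 * (_ + _) = (B i + (2 * i%:R + 4)) * (2 * E1 / 2 ^+ i)); last by ring.
    by rewrite ler_wpM2r// ltW// r0.
  rewrite ler_pM2l ?mulr_gt0// lerD// sum_affine_dyadic.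
  by rewrite lerBlDr lerDl divr_ge0 ?exprn_ge0 ?addr_ge0 ?mulr_ge0.
(* The sum pays for the finitely many [m] below the first block in use; on the later blocks 1 is
   enough. [K] does not depend on [J]. *)
pose K := 1 + \sum_(0 <= m < 2 ^ i0) Om m * (m.+1%:R * m.+2%:R).
have K1 : 1 <= K by rewrite lerDl sumr_ge0// => m _; rewrite !mulr_ge0// ltW.
exists K; first by rewrite (lt_le_trans _ K1).
move=> J.
pose g (J : nat) (n : int) := \prod_(i0 <= i < J) sinc (r i) n ^+ p i.
pose G (J : nat) (D : nat) := \prod_(i0 <= i < J) sinc_major (r i) D ^+ p i.
pose H (J : nat) := \sum_(i0 <= i < J) (p i)%:R * r i.
have G0 L D : 0 <= G L D.
  by apply: prodr_ge0 => i _; rewrite exprn_ge0// sinc_major_ge0.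
have H0 L : 0 <= H L by apply: sumr_ge0 => i _; rewrite mulr_ge0// ltW.
exists (g J), (G J), (H J); split => //.
- by rewrite H0 hi0.
- have triv L : (L <= i0)%N -> type_bound (H L) (G L) (g L).
    move=> Li0; have -> : H L = 0 by apply: big_geq.
    have -> : G L = fun=> 1 by apply/funext => n; apply: big_geq.
    have -> : g L = fun=> 1 by apply/funext => n; apply: big_geq.
    exact: type_bound1.
  elim: J => [|J IH]; first exact: triv.
  have [Ji|iJ] := ltnP J i0; first exact: triv.
  have -> : H J.+1 = H J + (p J)%:R * r J by rewrite /H big_nat_recr.
  have -> : G J.+1 = fun D => G J D * sinc_major (r J) D ^+ p J.
    by apply/funext => D; rewrite /G big_nat_recr.
  have -> : g J.+1 = fun n => g J n * sinc (r J) n ^+ p J.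
    by apply/funext => D; rewrite /g big_nat_recr.
  have sm0 D : 0 <= sinc_major (r J) D by exact: sinc_major_ge0.
  apply: type_boundM => //.
  + by rewrite mulr_ge0// ltW.
  + by move=> D; rewrite exprn_ge0.
  + apply: type_boundX => //; first exact: ltW.
    exact: type_bound_sinc.
- by rewrite /g big1// => i _; rewrite /sinc eqxx expr1n.
move=> m mJ.
have m0 : 0 < m.+1%:R * m.+2%:R :> R by rewrite mulr_gt0.
rewrite ler_pdivlMr//.
have G1 D : G J D <= 1.
  apply: prodr_ile1 => i _.
  have h0 : 0 <= sinc_major (r i) D by exact: sinc_major_ge0.
  by rewrite exprn_ge0//= exprn_ile1// sinc_major_le1.
have [mi|im] := ltnP m (2 ^ i0)%N.
  apply: (@le_trans _ _ (Om m * (m.+1%:R * m.+2%:R))).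
    by rewrite -mulrA ler_piMl// mulr_ge0// ltW.
  rewrite /K (bigD1_seq m) ?mem_index_iota ?iota_uniq//=.
  rewrite addrCA lerDl addr_ge0// sumr_ge0// => k _.
  by rewrite !mulr_ge0// ltW.
pose i := trunc_log 2 m.
have m_gt0 : (0 < m)%N by rewrite (leq_trans _ im)// expn_gt0.
have /andP[im1 im2] : (2 ^ i <= m < 2 ^ i.+1)%N by apply: trunc_log_bounds.
have i0i : (i0 <= i)%N by rewrite -ltnS -(@ltn_exp2l 2)// (leq_ltn_trans im).
have iJ : (i < J)%N by rewrite -(@ltn_exp2l 2)// (leq_ltn_trans im1).
apply: le_trans K1.
have h1 : G J m <= expR (- (p i)%:R).
  rewrite /G (bigD1_seq i) ?mem_index_iota ?iota_uniq//=; last by rewrite i0i.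
  apply: (@le_trans _ _ (sinc_major (r i) m ^+ p i)).
    rewrite ler_piMr ?exprn_ge0 ?sinc_major_ge0//.
    apply: prodr_ile1 => k _.
    have h0 : 0 <= sinc_major (r k) m by exact: sinc_major_ge0.
    by rewrite exprn_ge0//= exprn_ile1// sinc_major_le1.
  rewrite expRN -[(p i)%:R]mulr1 expRM_natl -exprVn.
  rewrite lerXn2r ?nnegrE ?sinc_major_ge0 ?invr_ge0 ?expR_ge0//.
  rewrite -/E1.
  have h2 : 2 * E1 <= r i * m%:R.
    rewrite /r mulrAC ler_pdivlMr// ler_wpM2l ?mulr_ge0 ?(ltW E10)//.
    by rewrite -natrX ler_nat.
  have E12 : 2 <= E1 by rewrite /E1 (le_trans _ (expR_ge1Dx 1))//.
  rewrite /sinc_major; case: (leP (r i * m%:R) 2) => h3; first by exfalso; move: h2 h3 E12; lra.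
  have q0 : 0 < r i * m%:R by rewrite (lt_trans _ h3).
  by rewrite ler_pdivrMr// mulrC ler_pdivlMr// mulrC mulrC.
have h2 : Om m <= expR (B i) by rewrite -{1}(lnK (Om0 m)) ler_expR BGa// im1.
have h3 : m.+1%:R * m.+2%:R <= expR (2 * i%:R + 3) :> R.
  have E12 : 2 <= E1 by rewrite /E1 (le_trans _ (expR_ge1Dx 1))//.
  apply: (@le_trans _ _ (2 ^+ i.+1 * 2 ^+ i.+2)).
    rewrite ler_pM// -natrX ler_nat//.
    rewrite (leq_trans (n := (2 ^ i.+1).+1))//.
    by rewrite [in leqRHS]expnS mul2n -addnn -addn1 leq_add2l expn_gt0.
  rewrite -exprD (_ : 2 * i%:R + 3 = (2 * i + 3)%:R * 1); last by rewrite mulr1 natrD natrM.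
  rewrite expRM_natl (_ : (i.+1 + i.+2 = 2 * i + 3)%N); last by lia.
  by rewrite lerXn2r ?nnegrE// ltW.
apply: (@le_trans _ _ (expR (- (p i)%:R) * expR (B i) * expR (2 * i%:R + 3))).
  apply: ler_pM => //; first by rewrite mulr_ge0// ltW.
  by apply: ler_pM => //; exact: ltW.
rewrite -!expRD -[leRHS]expR0 ler_expR.
by have /andP[+ _] := pB i; lra.
Qed.

End Multiplier.

(** * Sequences that are differences of every order *)

Section Pairing.
Variable R : realType.
Implicit Types (F g : int -> R).

(** The range is [- N .. N - 1], since [Negz n] is [- n - 1]. *)
Definition zsum (N : nat) F : R := \sum_(0 <= n < N) (F n%:Z + F (Negz n)).

Lemma zsum_by_parts N g (b : int -> R) :
  zsum N (fun n => g n * (b (n + 1) - b n)) =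
  - zsum N (fun n => dif g n * b n) + g (N%:Z - 1) * b N%:Z
  - g (- N%:Z - 1) * b (- N%:Z).
Proof.
rewrite /zsum; elim: N => [|N IH].
  by rewrite !big_geq// oppr0 !sub0r add0r subrr.
rewrite !big_nat_recr//= IH /dif.
rewrite (_ : Negz N + 1 = - N%:Z); last by lia.
rewrite (_ : Negz N = - N%:Z - 1); last by lia.
rewrite (_ : N.+1%:Z - 1 = N); last by lia.
rewrite (_ : - N.+1%:Z = - N%:Z - 1); last by lia.
rewrite (_ : N%:Z + 1 = N.+1); last by lia.
by ring.
Qed.

Lemma ler_norm_zsum N F F' : (forall n, (- N%:Z <= n < N%:Z) -> `|F n| <= F' n) ->
  `|zsum N F| <= zsum N F'.
Proof.
move=> h; apply: le_trans (ler_norm_sum _ _ _) _.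
apply: ler_sum_nat => n /andP[_ nN].
by rewrite (le_trans (ler_normD _ _))// lerD// h//; lia.
Qed.

(** A summable weight whose sums telescope, being [1 / (m + 1) - 1 / (m + 2)]. *)
Definition tele (m : nat) : R := (m.+1%:R * m.+2%:R)^-1.

Lemma tele_gt0 m : 0 < tele m.
Proof. by rewrite invr_gt0 mulr_gt0. Qed.

Lemma tele_ge0 m : 0 <= tele m. Proof. exact/ltW/tele_gt0. Qed.

Lemma tele_leV m : tele m <= m.+1%:R^-1.
Proof.
rewrite lef_pV2 ?posrE ?mulr_gt0// ler_peMr// ler1n//.
Qed.

Lemma tele_le1 m : tele m <= 1.
Proof. by apply: le_trans (tele_leV m) _; rewrite invf_le1// ler1n. Qed.

Lemma tele_le m n : (m <= n)%N -> tele n <= tele m.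
Proof.
move=> mn; rewrite lef_pV2 ?posrE ?mulr_gt0//.
by rewrite ler_pM// ler_nat.
Qed.

Lemma sum_tele m N : (m <= N)%N ->
  \sum_(m <= i < N) tele i = m.+1%:R^-1 - N.+1%:R^-1.
Proof.
move=> /subnK <-; elim: (N - m)%N => [|k IH].
  by rewrite add0n big_geq// subrr.
rewrite addSn big_nat_recr ?leq_addl//= IH /tele.
rewrite -[(k + m).+2%:R]natr1.
have ? : m.+1%:R != 0 :> R by [].
have ? : (k + m).+1%:R != 0 :> R by [].
have ? : (k + m).+1%:R + 1 != 0 :> R by rewrite natr1.
by field; apply/and3P; split => //; rewrite natr1.
Qed.

Lemma sum_tele_le m N : \sum_(m <= i < N) tele i <= m.+1%:R^-1.
Proof.
have [Nm|mN] := leqP N m; first by rewrite big_geq// invr_ge0.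
by rewrite sum_tele ?(ltnW mN)// gerBl invr_ge0.
Qed.

Lemma sum_tele_sub k N : \sum_(0 <= i < N) tele (i - k)%N <= k%:R + 1.
Proof.
apply: (@le_trans _ _ (\sum_(0 <= i < k + N) tele (i - k)%N)).
  rewrite [leRHS](big_cat_nat (n := N)) ?leq_addl//= lerDl sumr_ge0// => i _.
  exact: tele_ge0.
rewrite (big_cat_nat (n := k)) ?leq_addr//= lerD//.
  apply: (@le_trans _ _ (\sum_(0 <= i < k) 1)).
    by apply: ler_sum => i _; exact: tele_le1.
  by rewrite sumr_const_nat subn0.
rewrite -[X in \sum_(X <= _ < _) _]add0n big_addn addKn.
apply: (@le_trans _ _ (\sum_(0 <= i < N) tele i)).
  by apply: ler_sum => i _; rewrite addnK.
by apply: le_trans (sum_tele_le _ _) _; rewrite invr1.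
Qed.

(** * Pairing a divisible sequence with a multiplier *)

Section Core.
Variables (rho : int -> R) (s M : R).
Hypothesis rho_gt0 : forall n, 0 < rho n.
Hypothesis rho0 : rho 0 = 1.
Hypothesis rhoD : forall m n, rho (m + n) <= rho m * rho n.
Hypothesis sum_pos : forall N,
  \sum_(0 <= n < N) `|ln (rho n%:Z)| / (1 + (n%:Z%:~R) ^+ 2) <= s.
Hypothesis sum_neg : forall N,
  \sum_(0 <= n < N) `|ln (rho (Negz n))| / (1 + ((Negz n)%:~R) ^+ 2) <= s.
Hypothesis M_gt0 : 0 < M.

(** Symmetrised weight, to which the one-sided construction of multipliers applies. *)
Let Om (n : nat) : R := Num.max (rho n%:Z) (rho (- n%:Z)).

Let Om_gep n : rho n%:Z <= Om n. Proof. by rewrite le_max lexx. Qed.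
Let Om_gen n : rho (- n%:Z) <= Om n. Proof. by rewrite le_max lexx orbT. Qed.
Let Om_gt0 n : 0 < Om n. Proof. exact: lt_le_trans (Om_gep n). Qed.

Let Om_ge1 n : 1 <= Om n.
Proof.
have h : 1 <= rho n%:Z * rho (- n%:Z) by rewrite (le_trans _ (rhoD _ _))// subrr rho0.
rewrite leNgt; apply/negP => O1.
have := le_lt_trans (Om_gep n) O1; have := le_lt_trans (Om_gen n) O1.
move=> h1 h2; have : rho n%:Z * rho (- n%:Z) < 1 by rewrite mulr_ilt1// ltW.
by rewrite ltNge h.
Qed.

Let OmD m n : Om (m + n)%N <= Om m * Om n.
Proof.
rewrite {1}/Om ge_max; apply/andP; split.
  rewrite PoszD; apply: le_trans (rhoD _ _) _.
  by apply: ler_pM => //; exact: ltW.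
rewrite PoszD opprD; apply: le_trans (rhoD _ _) _.
by apply: ler_pM => //; exact: ltW.
Qed.

Let Om_sum N : \sum_(0 <= n < N) ln (Om n) / (1 + n%:R ^+ 2) <= s + s.
Proof.
have s0 n : (0 : R) <= (1 + n%:R ^+ 2)^-1 by rewrite invr_ge0 addr_ge0// sqr_ge0.
have h n : ln (Om n) <= `|ln (rho n%:Z)| + `|ln (rho (- n%:Z))|.
  rewrite /Om; case: (leP (rho n%:Z) (rho (- n%:Z))) => _.
    by rewrite (le_trans (ler_norm _))// lerDr.
  by rewrite (le_trans (ler_norm _))// lerDl.
apply: (@le_trans _ _ (\sum_(0 <= n < N) `|ln (rho n%:Z)| / (1 + n%:R ^+ 2) +
    \sum_(0 <= n < N) `|ln (rho (- n%:Z))| / (1 + n%:R ^+ 2))).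
  rewrite -big_split/=; apply: ler_sum => n _.
  by rewrite -mulrDl ler_wpM2r.
apply: lerD; first exact: sum_pos.
case: N => [|N]; first by rewrite big_geq//; have := sum_pos 0; rewrite big_geq.
rewrite big_nat_recl//= oppr0 rho0 ln1 normr0 mul0r add0r.
apply: le_trans (sum_neg N); apply: ler_sum => n _.
rewrite NegzE rmorphN/= sqrrN; exact: lexx.
Qed.

Let q := Om 1.
Let q1 : 1 <= q. Proof. exact: Om_ge1. Qed.
Let q0 : 0 < q. Proof. exact: Om_gt0. Qed.

Let Om_le k : Om k <= q ^+ k.
Proof.
elim: k => [|k IH]; first by rewrite /Om oppr0 maxxx rho0 expr0.
rewrite -addn1 (le_trans (OmD _ _))// addn1 exprSr ler_wpM2r//.
exact: ltW.
Qed.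

(** The distance from 0 to the interval [n - k .. n], hence the best [D] in [type_bound] for a
    difference of order [k] at [n]. *)
Let dist (k : nat) (n : int) : nat := if n < 0 then absz n else (absz n - k)%N.

Let distP k n i : (i <= k)%N -> (dist k n <= absz (n - i%:Z)%R)%N.
Proof. by rewrite /dist => ik; case: ifP => ?; lia. Qed.

(** Passing from [n] to the point of [n - k .. n] nearest to 0 takes at most [k] unit steps, each at
    the price of a factor [q]. *)
Let rho_dist k n : rho n <= q ^+ k * Om (dist k n).
Proof.
rewrite /dist; case: ifP => n0.
  apply: (@le_trans _ _ (Om (absz n))).
    by rewrite (le_trans _ (Om_gen _))// (_ : - _ = n)//; lia.
  by rewrite ler_peMl ?exprn_ege1// ltW.
have n0' : n = (absz n)%:Z by lia.
have [nk|kn] := leqP (absz n) k.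
  rewrite {1}n0' (le_trans (Om_gep _))// (le_trans (Om_le _))//.
  apply: (@le_trans _ _ (q ^+ k)); first by rewrite ler_weXn2l.
  by rewrite ler_peMr ?exprn_ge0// ltW.
rewrite {1}n0' (le_trans (Om_gep _))// -{1}(subnKC (ltnW kn)).
by rewrite (le_trans (OmD _ _))// ler_wpM2r// ltW.
Qed.

(** Three geometric factors meet here: [M ^+ k] from the resolvent, [H ^+ k] from the multiplier and
    [q ^+ k] from [rho_dist]. The bound on [H] makes their product at most [4 ^- k]. *)
Let multiplier_bound (K H : R) (J : nat) g (G : nat -> R) k n :
  0 <= H <= (4 * M * q)^-1 -> 0 < K ->
  type_bound H G g -> (forall D, 0 <= G D) ->
  (forall m, (m < 2 ^ J)%N -> G m * Om m <= K / (m.+1%:R * m.+2%:R)) ->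
  (absz n < 2 ^ J)%N ->
  M ^+ k * `|iter k dif g n| * rho n <= K / 4 ^+ k * tele (dist k n).
Proof.
move=> /andP[H0 He] K0 gB G0 GJ nJ.
have dJ : (dist k n < 2 ^ J)%N.
  by rewrite (leq_ltn_trans _ nJ)// /dist; case: ifP; lia.
have h := gB k n (dist k n) (fun i ik => distP n ik).
apply: (@le_trans _ _ (M ^+ k * (H ^+ k * G (dist k n)) * (q ^+ k * Om (dist k n)))).
  apply: ler_pM => //; first by rewrite mulr_ge0// exprn_ge0// ltW.
    exact: ltW.
  by rewrite ler_wpM2l// exprn_ge0// ltW.
have -> : M ^+ k * (H ^+ k * G (dist k n)) * (q ^+ k * Om (dist k n)) =
   (M * H * q) ^+ k * (G (dist k n) * Om (dist k n)) by rewrite !exprMn; ring.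
have -> : K / 4 ^+ k * tele (dist k n) = 4^-1 ^+ k * (K * tele (dist k n)).
  by rewrite exprVn; ring.
apply: ler_pM => //.
- by rewrite exprn_ge0// !mulr_ge0// ltW.
- by rewrite mulr_ge0// ltW.
- rewrite lerXn2r ?nnegrE ?invr_ge0 ?mulr_ge0 ?(ltW M_gt0) ?(ltW q0)//.
  have -> : 4^-1 = M * (4 * M * q)^-1 * q.
    by field; rewrite !gt_eqF.
  by rewrite ler_wpM2r ?(ltW q0)// ler_wpM2l// ltW.
- exact: GJ.
Qed.

(** Each of the [k] summations by parts moves one difference onto [g] and leaves two boundary terms
    of order [1 / (N - k)]. What remains at the end is of order [(k + 2) / 4 ^+ k]. *)
Let pairing_bound (K H L : R) (J N k : nat) g (G : nat -> R) (b : nat -> int -> R) :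
  0 <= H <= (4 * M * q)^-1 -> 0 < K ->
  type_bound H G g -> (forall D, 0 <= G D) ->
  (forall m, (m < 2 ^ J)%N -> G m * Om m <= K / (m.+1%:R * m.+2%:R)) ->
  (forall k n, b k n = b k.+1 (n + 1) - b k.+1 n) ->
  (forall k n, `|b k n| <= L * M ^+ k * rho n) ->
  (N.+1 < 2 ^ J)%N -> (k < N)%N -> 0 <= L ->
  `|zsum N (fun n => g n * b 0%N n)| <=
  L * K * (2 / 2 ^+ k) + k%:R * (2 * L * K * M * q * (N - k)%:R^-1).
Proof.
move=> He K0 gB G0 GJ brec bL NJ kN L0.
have mb i n := @multiplier_bound K H J g G i n He K0 gB G0 GJ.
have p2 i : 0 < 2 ^+ i :> R by rewrite exprn_gt0.
have p4 i : 0 < 4 ^+ i :> R by rewrite exprn_gt0.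
have p4' i : K / 4 ^+ i <= K.
  by rewrite ler_pdivrMr// ler_peMr ?(ltW K0)// exprn_ege1// ler1n.
have step j : (j < k)%N ->
  `|zsum N (fun n => iter j dif g n * b j n)| <=
  `|zsum N (fun n => iter j.+1 dif g n * b j.+1 n)| +
    2 * L * K * M * q * (N - k)%:R^-1.
  move=> jk.
  have -> : (fun n => iter j dif g n * b j n) =
      (fun n => iter j dif g n * (b j.+1 (n + 1) - b j.+1 n)).
    by apply/funext => n; rewrite brec.
  rewrite zsum_by_parts -addrA (le_trans (ler_normD _ _))// normrN lerD//.
  rewrite (le_trans (ler_normB _ _))//.
  (* A boundary term pairs [g] at [n' = n - 1] with [b] at [n]; the factor [q] pays for this
     offset. *)
  have bnd n n' : rho n <= q * rho n' ->
      (absz n' < 2 ^ J)%N -> (N - k <= (dist j n').+1)%N ->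
      `|iter j dif g n' * b j.+1 n| <= L * K * M * q * (N - k)%:R^-1.
    move=> nn' n'J Nk; rewrite normrM.
    apply: (@le_trans _ _ (`|iter j dif g n'| * (L * M ^+ j.+1 * (q * rho n')))).
      rewrite ler_wpM2l// (le_trans (bL _ _))// ler_wpM2l//.
      by rewrite mulr_ge0// exprn_ge0// ltW.
    have -> : `|iter j dif g n'| * (L * M ^+ j.+1 * (q * rho n')) =
       L * M * q * (M ^+ j * `|iter j dif g n'| * rho n') by rewrite exprS; ring.
    have -> : L * K * M * q * (N - k)%:R^-1 = L * M * q * (K * (N - k)%:R^-1) by ring.
    rewrite ler_wpM2l ?mulr_ge0 ?(ltW M_gt0) ?(ltW q0)//.
    apply: le_trans (mb _ _ n'J) _.
    apply: ler_pM => //.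
    - by rewrite divr_ge0// ltW.
    - exact: tele_ge0.
    - apply: le_trans (tele_leV _) _.
      by rewrite lef_pV2 ?posrE ?ltr0n ?subn_gt0// ler_nat.
  have -> : 2 * L * K * M * q * (N - k)%:R^-1 =
    L * K * M * q * (N - k)%:R^-1 + L * K * M * q * (N - k)%:R^-1 by ring.
  have rho1q : rho 1 <= q by exact: Om_gep.
  apply: lerD; apply: bnd.
  - rewrite -{1}(subrK 1 N%:Z) (le_trans (rhoD _ _))// mulrC ler_wpM2r//.
    exact: ltW.
  - by move: NJ; clear; lia.
  - by rewrite /dist; move: jk kN; clear; case: ifP; lia.
  - rewrite -{1}(subrK 1 (- N%:Z)) (le_trans (rhoD _ _))// mulrC ler_wpM2r//.
    exact: ltW.
  - by move: NJ; clear; lia.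
  - by rewrite /dist; move: jk kN; clear; case: ifP; lia.
have steps j : (j <= k)%N ->
  `|zsum N (fun n => g n * b 0%N n)| <=
  `|zsum N (fun n => iter j dif g n * b j n)| +
    j%:R * (2 * L * K * M * q * (N - k)%:R^-1).
  elim: j => [|j IH] jk; first by rewrite mul0r addr0.
  rewrite (le_trans (IH (ltnW jk)))// -natr1 mulrDl mul1r.
  by have := step _ jk; lra.
apply: le_trans (steps _ (leqnn k)) _.
rewrite lerD2r.
apply: le_trans (ler_norm_zsum (F' := fun n => L * (K / 4 ^+ k) * tele (dist k n)) _) _.
  move=> n nN; rewrite normrM.
  apply: (@le_trans _ _ (L * (M ^+ k * `|iter k dif g n| * rho n))).
    rewrite (_ : L * _ = `|iter k dif g n| * (L * M ^+ k * rho n)); last by ring.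
    by rewrite ler_wpM2l.
  by rewrite -[leRHS]mulrA ler_wpM2l// mb//; lia.
have -> : zsum N (fun n => L * (K / 4 ^+ k) * tele (dist k n)) =
   L * (K / 4 ^+ k) * (\sum_(0 <= n < N) tele (n - k)%N +
     \sum_(0 <= n < N) tele n.+1).
  by rewrite /zsum -big_split/= mulr_sumr; apply: eq_bigr => n _; rewrite mulrDr.
have h1 := sum_tele_sub k N.
have h2 : \sum_(0 <= n < N) tele n.+1 <= 1.
  apply: (@le_trans _ _ (\sum_(0 <= n < N) tele n)).
    by apply: ler_sum => n _; exact: tele_le.
  by apply: le_trans (sum_tele_le _ _) _; rewrite invr1.
have h3 : k%:R + 2 <= 2 * 2 ^+ k :> R.
  rewrite -natrX -natrM -natrD ler_nat.
  by clear; elim: k => // i IH; rewrite expnS; lia.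
rewrite -!mulrA ler_wpM2l// ler_wpM2l ?(ltW K0)//.
rewrite ler_pdivrMl// (_ : 4 ^+ k * (2 * _) = 2 * 2 ^+ k); first by lra.
rewrite (_ : 4 = 2 * 2) ?exprMn; last by ring.
by field; rewrite gt_eqF.
Qed.

(** [N0] and [e0] depend only on [rho] and [M], not on [b] or [L], so a peaking function can be
    chosen after them, however large its norm. The pairing is at most 1/4, and so is the sum of its
    terms with [n != 0]; this leaves at most 1/2 for the term at 0. *)
Lemma divisible_seq_lt1 : exists N0, exists2 e0 : R, 0 < e0 &
  forall (b : nat -> int -> R) (L : R),
  (forall k n, b k n = b k.+1 (n + 1) - b k.+1 n) ->
  (forall k n, `|b k n| <= L * M ^+ k * rho n) ->
  (forall n, `|b 0%N n| <= rho n) ->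
  (forall n, (0 < absz n <= N0)%N -> `|b 0%N n| <= e0 * rho n) ->
  `|b 0%N 0| < 1.
Proof.
have e_gt0 : 0 < (4 * M * q)^-1 by rewrite invr_gt0 !mulr_gt0.
have [K K0 mult] := exists_multiplier Om_ge1 OmD Om_sum e_gt0.
(* Beyond [N0] the sums of [K * tele] are at most 1/16. *)
have [N0 N0P] : exists N0 : nat, 16 * K < N0.+1%:R.
  by exists (Num.truncn (16 * K)); apply: truncnS_gt.
exists N0, (16 * K)^-1; first by rewrite invr_gt0 mulr_gt0.
move=> b L brec bL b1 b2.
have L0 : 0 <= L.
  by have := bL 0%N 0; rewrite expr0 rho0 !mulr1; apply: le_trans.
(* First [k] makes the main term small; then [N], depending on [k], makes the [k] pairs of boundary
   terms small. *)
have [k hk] : exists k, L * K * (2 / 2 ^+ k) <= 8^-1.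
  have [k kP] : exists k : nat, 16 * L * K < k.+1%:R.
    by exists (Num.truncn (16 * L * K)); apply: truncnS_gt.
  exists k.
  have k2 : k.+1%:R <= 2 ^+ k :> R by rewrite -natrX ler_nat; exact: ltn_expl.
  rewrite mulrA ler_pdivrMr ?exprn_gt0//; lra.
pose C := k%:R * (2 * L * K * M * q).
have C0 : 0 <= C by rewrite !mulr_ge0// ltW.
have [N [kN NP]] : exists N, (k < N)%N /\ 8 * C < (N - k)%:R.
  exists (k + (Num.truncn (8 * C)).+1)%N.
  by rewrite addKn addnS ltnS leq_addr; split=> //; apply: truncnS_gt.
have N_gt0 : (0 < N)%N by rewrite (leq_ltn_trans _ kN).
(* The exponent [N.+2] ensures that the decay of [G] holds up to the outermost index in use,
   [- N - 1]. *)
have [g [G [H [He gB g0 G0 GJ]]]] := mult N.+2.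
have NJ : (N.+1 < 2 ^ N.+2)%N by rewrite (ltn_trans _ (ltn_expl _ _)).
have := pairing_bound He K0 gB G0 GJ brec bL NJ kN L0.
have hC : k%:R * (2 * L * K * M * q * (N - k)%:R^-1) <= 8^-1.
  rewrite mulrA -/C ler_pdivrMr ?ltr0n ?subn_gt0//.
  by move: NP; lra.
move=> hz.
have {hk hC}hz : `|zsum N (fun n => g n * b 0%N n)| <= 4^-1 by move: hz hk hC; lra.
have gb (n : int) : (absz n < 2 ^ N.+2)%N -> `|g n| * rho n <= K * tele (absz n).
  move=> nJ; have := @multiplier_bound K H N.+2 g G 0%N n He K0 gB G0 GJ nJ.
  rewrite !expr0 mul1r divr1 /=.
  by rewrite (_ : dist 0 n = absz n)// /dist subn0; case: ifP.
(* Majorant of the terms with [n != 0]: close to 0 the sequence is small by a factor [e0], far away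
   the multiplier alone is small. Each part sums to at most 1/16. *)
pose tau (m : nat) := (16 * K)^-1 * (K * tele m) +
  (if (N0 < m)%N then K * tele m else 0).
have term (n : int) : n != 0 -> (absz n <= N)%N -> `|g n * b 0%N n| <= tau (absz n).
  move=> n0 nN.
  have nJ : (absz n < 2 ^ N.+2)%N by rewrite (leq_ltn_trans nN)// (ltn_trans _ NJ).
  have ht := tele_ge0 (absz n).
  have e0 : 0 <= (16 * K)^-1 by rewrite invr_ge0 mulr_ge0// ltW.
  rewrite normrM /tau; case: ltnP => hN0.
    apply: (@le_trans _ _ (K * tele (absz n))).
      by apply: le_trans (gb _ nJ); rewrite ler_wpM2l.
    by rewrite lerDr mulr_ge0// mulr_ge0// ltW.
  rewrite addr0; apply: (@le_trans _ _ ((16 * K)^-1 * (`|g n| * rho n))).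
    rewrite mulrCA ler_wpM2l// b2//.
    by rewrite hN0 absz_gt0 n0.
  by rewrite ler_wpM2l// gb.
have sum_tau m : \sum_(m <= i < N.+1) tau i <= 8^-1.
  rewrite big_split/= -!mulr_sumr.
  have h1 : \sum_(m <= i < N.+1) tele i <= 1.
    apply: le_trans (sum_tele_le _ _) _.
    by rewrite invf_le1// ler1n.
  have h2 : \sum_(m <= i < N.+1) (if (N0 < i)%N then K * tele i else 0) <= 16^-1.
    apply: (@le_trans _ _ (\sum_(0 <= i < N.+1) (if (N0 < i)%N then K * tele i else 0))).
      have [mN|Nm] := leqP m N.+1; last first.
        rewrite [leLHS]big_geq ?(ltnW Nm)// sumr_ge0// => i _.
        by case: ifP => // _; rewrite mulr_ge0 ?tele_ge0// ltW.
      rewrite [leRHS](big_cat_nat (n := m))//= lerDr sumr_ge0// => i _.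
      by case: ifP => // _; rewrite mulr_ge0 ?tele_ge0// ltW.
    rewrite -big_mkcond/= -mulr_sumr.
    have -> : \sum_(0 <= i < N.+1 | (N0 < i)%N) tele i = \sum_(N0.+1 <= i < N.+1) tele i.
      by rewrite [RHS](big_nat_widenl _ 0)//.
    apply: le_trans (ler_wpM2l (ltW K0) (sum_tele_le _ _)) _.
    rewrite ler_pdivrMr//.
    have : N0.+1%:R <= N0.+2%:R :> R by rewrite ler_nat.
    by move: N0P; lra.
  have h3 : (16 * K)^-1 * (K * \sum_(m <= i < N.+1) tele i) <= 16^-1.
    rewrite mulrA (_ : (16 * K)^-1 * K = 16^-1); last by field; rewrite gt_eqF.
    by rewrite ler_piMr.
  by move: h2 h3; lra.
have : `|b 0%N 0| <= `|zsum N (fun n => g n * b 0%N n)| + 8^-1 + 8^-1.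
  have -> : zsum N (fun n => g n * b 0%N n) = b 0%N 0 +
     (\sum_(1 <= n < N) g n%:Z * b 0%N n%:Z + \sum_(0 <= n < N) g (Negz n) * b 0%N (Negz n)).
    rewrite /zsum big_split/= addrA; congr (_ + _).
    by rewrite big_ltn// g0 mul1r.
  set X := \sum_(1 <= _ < _) _; set Y := \sum_(0 <= _ < _) _.
  have hX : `|X| <= 8^-1.
    apply: le_trans (ler_norm_sum _ _ _) _.
    apply: le_trans (sum_tau 1%N).
    rewrite [leRHS]big_nat_recr//=.
    apply: (@le_trans _ _ (\sum_(1 <= i < N) tau i)).
      by apply: ler_sum_nat => n /andP[n1 n2]; apply: term; move: n1 n2; clear; lia.
    rewrite lerDl /tau addr_ge0//.
      by rewrite !mulr_ge0 ?invr_ge0 ?tele_ge0 ?mulr_ge0// ltW.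
    by case: ifP => // _; rewrite mulr_ge0 ?tele_ge0// ltW.
  have hY : `|Y| <= 8^-1.
    apply: le_trans (ler_norm_sum _ _ _) _.
    apply: le_trans (sum_tau 1%N).
    rewrite big_add1/=.
    by apply: ler_sum_nat => n /andP[n1 n2]; apply: term; move: n1 n2; clear; lia.
  have := ler_normB (b 0%N 0 + (X + Y)) (X + Y); rewrite addrK.
  by have := ler_normD X Y; lra.
by move: hz; lra.
Qed.

End Core.
End Pairing.

(** * Characters *)

Section ComplexModulus.
Variable R : realType.
Local Notation C := (complex R).
Implicit Types z : C.

Lemma normC_real (V : normedModType C) (x : V) : (complex.Re `|x|)%:C%C = `|x|.
Proof. by rewrite RRe_real// ger0_real. Qed.

Lemma cabsE z : (cabs z)%:C%C = `|z|.
Proof. by rewrite /cabs RRe_real// ger0_real. Qed.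

Lemma cabs_ge0 z : 0 <= cabs z.
Proof. by rewrite -lecR cabsE; exact: normr_ge0. Qed.

Lemma cabsM z1 z2 : cabs (z1 * z2) = cabs z1 * cabs z2.
Proof. by apply: (@complexI R); rewrite rmorphM/= !cabsE normrM. Qed.

Lemma cabs0 : cabs (0 : C) = 0.
Proof. by rewrite /cabs normr0. Qed.

Lemma cabs1 : cabs (1 : C) = 1.
Proof. by rewrite /cabs normr1. Qed.

Lemma cabsX z n : cabs (z ^+ n) = cabs z ^+ n.
Proof. by elim: n => [|n IH]; rewrite ?expr0 ?cabs1// !exprS cabsM IH. Qed.

Lemma cabsN z : cabs (- z) = cabs z.
Proof. by rewrite /cabs normrN. Qed.

Lemma cabsB z1 z2 : cabs (z1 - z2) = cabs (z2 - z1).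
Proof. by rewrite -cabsN opprB. Qed.

Lemma cabsD z1 z2 : cabs (z1 + z2) <= cabs z1 + cabs z2.
Proof. by rewrite -lecR rmorphD/= !cabsE ler_normD. Qed.

Lemma cabsV z : cabs z^-1 = (cabs z)^-1.
Proof. by apply: (@complexI R); rewrite fmorphV/= !cabsE normfV. Qed.

Lemma cabs_eq0 z : (cabs z == 0) = (z == 0).
Proof. by rewrite -(inj_eq (@complexI R)) cabsE normr_eq0. Qed.

Lemma cabs_gt0 z : (0 < cabs z) = (z != 0).
Proof. by rewrite lt_neqAle cabs_ge0 andbT eq_sym cabs_eq0. Qed.

Lemma cabs_dist z1 z2 : `|cabs z1 - cabs z2| <= cabs (z1 - z2).
Proof.
have h1 := cabsD (z1 - z2) z2; have h2 := cabsD (z2 - z1) z1.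
by move: h1 h2; rewrite !subrK (cabsB z2) ler_norml; lra.
Qed.

Lemma normRe_le_cabs z : `|complex.Re z| <= cabs z.
Proof. by rewrite -lecR cabsE normc_ge_Re. Qed.

Lemma cabs_i : cabs ('i%C : C) = 1.
Proof. by rewrite /cabs normc_def/= expr0n/= add0r expr1n sqrtr1. Qed.

Lemma normIm_le_cabs z : `|complex.Im z| <= cabs z.
Proof.
by rewrite -normrN -ReiNIm (le_trans (normRe_le_cabs _))// cabsM cabs_i mulr1.
Qed.

Lemma cabs_le_ReIm z : cabs z <= `|complex.Re z| + `|complex.Im z|.
Proof.
rewrite [z in cabs z]complexE (le_trans (cabsD _ _))// cabsM.
have cr (x : R) : cabs (x%:C)%C = `|x|.
  by rewrite /cabs normc_def/= expr0n/= addr0 sqrtr_sqr.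
by rewrite cabs_i mul1r !cr.
Qed.

Lemma cabs_eq0_small z : (forall e, 0 < e -> cabs z < e) -> z = 0.
Proof.
move=> h; apply/eqP; rewrite -cabs_eq0 eq_le cabs_ge0 andbT leNgt; apply/negP => z0.
by have := h _ z0; rewrite ltxx.
Qed.

End ComplexModulus.

(** * Limits of bounded functions along an ultrafilter *)

Section UltraLimit.
Variables (R : realType) (T : Type) (F : set_system T).
Hypothesis FU : UltraFilter F.

(** The limit is the supremum of the [x] lying below [h] on a set of the ultrafilter. *)
Lemma ultra_limit_real (h : T -> R) (c : R) : F [set t | `|h t| <= c] ->
  exists l, forall e, 0 < e -> F [set t | `|h t - l| < e].
Proof.
move=> hc.
pose S := [set x | F [set t | x < h t]].
have S0 : S !=set0.
  exists (- c - 1); apply: filterS hc => t /=.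
  by rewrite ler_norml => /andP[+ _]; lra.
have Sub : ubound S c.
  move=> x Sx; have [t []] := filter_ex (filterI Sx hc).
  rewrite /= ler_norml => + /andP[_]; lra.
have hS : has_sup S by split => //; exists c.
exists (sup S) => e e0.
have [x Sx xe] := sup_adherent e0 hS.
have nS : ~ S (sup S + e / 2).
  by move=> /(sup_upper_bound hS); lra.
have nS' : F [set t | h t <= sup S + e / 2].
  case: (in_ultra_setVsetC [set t | sup S + e / 2 < h t] FU) => //.
  by apply: filterS => t /= /negP; rewrite -leNgt.
apply: filterS (filterI Sx nS') => t /= [h1 h2].
rewrite ltr_norml; move: h1 h2 xe; lra.
Qed.

Lemma ultra_limit_complex (h : T -> complex R) (c : R) : F [set t | cabs (h t) <= c] ->
  exists l, forall e, 0 < e -> F [set t | cabs (h t - l) < e].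
Proof.
move=> hc.
have [|a ha] := @ultra_limit_real (fun t => complex.Re (h t)) c.
  by apply: filterS hc => t /=; apply: le_trans (normRe_le_cabs _).
have [|b hb] := @ultra_limit_real (fun t => complex.Im (h t)) c.
  by apply: filterS hc => t /=; apply: le_trans (normIm_le_cabs _).
exists (a +i* b)%C => e e0.
have e2 : 0 < e / 2 by rewrite divr_gt0.
apply: filterS (filterI (ha _ e2) (hb _ e2)) => t /= [h1 h2].
apply: le_lt_trans (cabs_le_ReIm _) _.
rewrite !raddfB/=; move: h1 h2; lra.
Qed.
End UltraLimit.

(** * Multiplicative functionals of a commutative Banach algebra *)

Section Characters.
Variable R : realType.
Local Notation C := (complex R).
Variable A : completeNormedModType C.
Variables (mul : A -> A -> A) (one : A).
Hypothesis Alg : is_comBanachAlg mul one.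
Implicit Types (x y f : A) (chi psi : A -> C).

(** The norm of [A] takes its values in [C]; the real part gives access to the order of [R]. *)
Definition nrm x : R := complex.Re `|x|.

Lemma nrmE x : (nrm x)%:C%C = `|x|. Proof. exact: normC_real. Qed.
Lemma nrm_ge0 x : 0 <= nrm x.
Proof. by rewrite -lecR nrmE; exact: normr_ge0. Qed.
Lemma nrmD x y : nrm (x + y) <= nrm x + nrm y.
Proof. by rewrite -lecR rmorphD/= !nrmE ler_normD. Qed.
Lemma nrmZ (a : C) x : nrm (a *: x) = cabs a * nrm x.
Proof. by apply: (@complexI R); rewrite rmorphM/= !nrmE cabsE normrZ. Qed.
Lemma nrmM x y : nrm (mul x y) <= nrm x * nrm y.
Proof. by rewrite -lecR rmorphM/= !nrmE; exact: cba_normM Alg _ _. Qed.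
Lemma nrmB x y : nrm (x - y) = nrm (y - x).
Proof. by rewrite /nrm distrC. Qed.
Lemma nrm_eq0 x : nrm x = 0 -> x = 0.
Proof. by move=> h; apply/eqP; rewrite -normr_eq0 -nrmE h. Qed.

Lemma cba_mulDr x y z : mul x (y + z) = mul x y + mul x z.
Proof. by rewrite !(cba_mulC Alg x) (cba_mulDl Alg). Qed.

Lemma cba_mulr0 x : mul x 0 = 0.
Proof. by apply: (addIr (mul x 0)); rewrite -cba_mulDr !add0r. Qed.

Lemma cba_mulNr x y : mul x (- y) = - mul x y.
Proof. by rewrite -scaleN1r !(cba_mulC Alg x) (cba_mulZl Alg) scaleN1r. Qed.

(* [z] is the Neumann series of [y], the limit of the iterates of [z |-> one + y z]. *)
Lemma neumann y : nrm y < 1 -> exists z, z = one + mul y z.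
Proof.
move=> y1; pose q := nrm y.
have q0 : 0 <= q by exact: nrm_ge0.
pose z n := iter n (fun z => one + mul y z) 0.
have zd n : nrm (z n.+1 - z n) <= q ^+ n * nrm one.
  elim: n => [|n IH].
    by rewrite /z /= subr0 cba_mulr0 addr0 expr0 mul1r.
  rewrite (_ : z n.+2 - z n.+1 = mul y (z n.+1 - z n)); last first.
    by rewrite cba_mulDr cba_mulNr /z [in LHS]iterS [iter n.+1 _ _ in X in _ - X]iterS
      opprD addrACA subrr add0r.
  apply: le_trans (nrmM _ _) _.
  by rewrite exprS -mulrA ler_wpM2l.
pose c := nrm one / (1 - q).
have c0 : 0 <= c by rewrite divr_ge0 ?nrm_ge0// subr_ge0 ltW.
(* The factor [1 - q ^+ k] records the exact partial geometric sum, which the induction on [k]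
   needs. *)
have zdd n k : nrm (z (n + k)%N - z n) <= c * q ^+ n * (1 - q ^+ k).
  elim: k => [|k IH]; first by rewrite addn0 subrr /nrm normr0 expr0 subrr mulr0.
  rewrite addnS -(subrKA (z (n + k)%N)) (le_trans (nrmD _ _))//.
  apply: le_trans (lerD (zd _) IH) _.
  have -> : nrm one = c * (1 - q) by rewrite divfK// subr_eq0 eq_sym lt_eqF.
  by rewrite le_eqVlt; apply/orP; left; apply/eqP; rewrite exprD exprS; ring.
have zdd' n k : nrm (z (n + k)%N - z n) <= c * q ^+ n.
  apply: le_trans (zdd n k) _; rewrite ler_piMr ?(mulr_ge0 c0) ?exprn_ge0//.
  by rewrite gerBl exprn_ge0.
have qN e : 0 < e -> exists N, 2 * (c * q ^+ N) < e.
  move=> e0; have := @cvg_geometric R (2 * c) q; rewrite ger0_norm// => /(_ y1).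
  move=> /cvgrPdist_lt/(_ _ e0)[N _ /(_ N (leqnn N))] /=.
  rewrite sub0r normrN -mulrA ger0_norm => [h|]; first by exists N.
  by rewrite mulr_ge0// mulr_ge0// exprn_ge0.
have zc : cvgn z.
  apply/cauchy_cvgP; apply/cauchy_ballP => e e0.
  have eR : (complex.Re e)%:C%C = e by rewrite RRe_real// gtr0_real.
  have [N hN] : exists N, 2 * (c * q ^+ N) < complex.Re e.
    by apply: qN; rewrite -ltcR eR.
  exists (z @` [set n | (N <= n)%N], z @` [set n | (N <= n)%N]).
    by split; exists N => // n Nn; exists n.
  move=> [_ _] [/= [n Nn <-] [m Nm <-]]; rewrite -ball_normE/=.
  rewrite -nrmE -eR ltcR; apply: le_lt_trans hN.
  rewrite -(subrKA (z N)) (le_trans (nrmD _ _))// mulr2n mulrDl mul1r lerD//.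
    by rewrite -(subnKC Nn).
  by rewrite nrmB -(subnKC Nm).
exists (limn z).
apply/eqP; rewrite -subr_eq0; apply/eqP/nrm_eq0/eqP; rewrite eq_le nrm_ge0 andbT.
rewrite leNgt; apply/negP => l0.
set l := limn z in l0 *.
have e0 : 0 < ((nrm (l - (one + mul y l)) / 2)%:C)%C :> C.
  by rewrite ltcR divr_gt0.
have /cvgrPdist_lt/(_ _ e0)[N _ hN] := zc.
have h1 := hN N (leqnn N); have h2 := hN N.+1 (leqnSn N).
move: h1 h2 => /=; rewrite -/l -!nrmE !ltcR => h1 h2.
have : nrm (l - (one + mul y l)) <= nrm (l - z N.+1) + nrm (z N.+1 - (one + mul y l)).
  by rewrite -{1}(subrKA (z N.+1)) nrmD.
have -> : z N.+1 - (one + mul y l) = mul y (z N - l).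
  by rewrite cba_mulDr cba_mulNr /z iterS opprD addrACA subrr add0r.
have := nrmM y (z N - l); rewrite nrmB.
have : nrm y * nrm (l - z N) <= nrm (l - z N) by rewrite ler_piMl ?nrm_ge0// ltW.
by move: h1 h2; lra.
Qed.

Section OneCharacter.
Variables (chi : A -> C) (chiP : is_char mul one chi).

Lemma charD x y : chi (x + y) = chi x + chi y.
Proof. by case: chiP => h _ _; rewrite -[x]scale1r h mul1r scale1r. Qed.
Lemma char0 : chi 0 = 0.
Proof. by apply: (addIr (chi 0)); rewrite -charD !add0r. Qed.
Lemma charZ (a : C) x : chi (a *: x) = a * chi x.
Proof. by case: chiP => h _ _; rewrite -[a *: x]addr0 h char0 addr0. Qed.
Lemma charN x : chi (- x) = - chi x.
Proof. by rewrite -scaleN1r charZ mulN1r. Qed.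
Lemma charB x y : chi (x - y) = chi x - chi y.
Proof. by rewrite charD charN. Qed.
Lemma charM x y : chi (mul x y) = chi x * chi y.
Proof. by case: chiP. Qed.
Lemma char1 : chi one = 1. Proof. by case: chiP. Qed.

Definition apow x n := iter n (mul x) one.

Lemma charX x n : chi (apow x n) = chi x ^+ n.
Proof. by elim: n => [|n IH]; rewrite ?expr0 ?char1// exprS /= charM IH. Qed.

(** If [chi x] exceeded the norm, the Neumann series for [y = x / chi x] would give [z = one + y z];
    as [chi y = 1], applying [chi] yields [0 = 1]. *)
Lemma char_le x : cabs (chi x) <= nrm x.
Proof.
rewrite leNgt; apply/negP => h.
have cx0 : 0 < cabs (chi x) by rewrite (le_lt_trans (nrm_ge0 x)).
have [|z] := @neumann ((chi x)^-1 *: x).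
  by rewrite nrmZ cabsV mulrC ltr_pdivrMr// mul1r.
move=> /(congr1 chi); rewrite charD charM charZ char1 mulVf; last by rewrite -cabs_gt0.
by rewrite mul1r -{1}[chi z]add0r => /addIr/eqP; rewrite eq_sym oner_eq0.
Qed.
End OneCharacter.

End Characters.

(** * The Shilov boundary *)

Lemma exists_expr_small (R : realType) (q c e : R) : 0 <= q < 1 -> 0 <= c -> 0 < e ->
  exists n, c * q ^+ n < e.
Proof.
move=> /andP[q0 q1] c0 e0; have := @cvg_geometric R c q; rewrite ger0_norm// => /(_ q1).
move=> /cvgrPdist_lt/(_ _ e0)[N _ /(_ N (leqnn N))] /=.
rewrite sub0r normrN ger0_norm => [h|]; first by exists N.
by rewrite mulr_ge0// exprn_ge0.
Qed.

Section ShilovBoundary.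
Variable R : realType.
Local Notation C := (complex R).
Variable A : completeNormedModType C.
Variables (mul : A -> A -> A) (one : A).
Hypothesis Alg : is_comBanachAlg mul one.
Hypothesis Ass : semisimple mul one.
Implicit Types (x y f : A) (chi psi : A -> C) (B : set (A -> C)).
Local Notation is_char := (is_char mul one).
Local Notation MA := (MA mul one).
Local Notation gclosed := (gclosed mul one).
Local Notation is_boundary := (is_boundary mul one).

Lemma exists_char : exists chi, is_char chi.
Proof.
have [//|h] := pselect (exists chi, is_char chi).
have : one = 0 by apply: Ass => chi hc; case: h; exists chi.
by move/eqP; rewrite (negPf (cba_one_neq0 Alg)).
Qed.

(** * Compactness of the maximal ideal space *)

Section Ultra.
Variable F : set_system (A -> C).
Hypothesis FU : UltraFilter F.

(** The values at [f] are bounded by [nrm f], so they converge along the ultrafilter for each [f];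
    linearity and multiplicativity pass to the limit. This is the weak-star compactness of the set
    of characters. *)
Lemma char_ultra_limit : F MA -> exists2 chi, is_char chi &
  forall f e, 0 < e -> F [set psi | cabs (psi f - chi f) < e].
Proof.
move=> FM.
have lim f : exists l, forall e, 0 < e -> F [set psi | cabs (psi f - l) < e].
  apply: (@ultra_limit_complex _ _ _ FU (fun psi : A -> C => psi f) (nrm f)).
  by apply: filterS FM => psi psiP /=; exact: (char_le Alg psiP).
have [chi chiP] := choice lim.
exists chi; last exact: chiP.
split.
- move=> a x y; apply/eqP; rewrite -subr_eq0; apply/eqP/cabs_eq0_small => e e0.
  have a0 := cabs_ge0 a.
  pose d := e / (3 + cabs a).
  have c0 : 0 < 3 + cabs a by lra.
  have d0 : 0 < d by rewrite divr_gt0.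
  have de : e = d * (3 + cabs a) by rewrite divfK// gt_eqF.
  have [psi [psiP [h1 [h2 h3]]]] := filter_ex (filterI FM (filterI (chiP (a *: x + y) _ d0)
    (filterI (chiP x _ d0) (chiP y _ d0)))).
  have E : chi (a *: x + y) - (a * chi x + chi y) =
    (chi (a *: x + y) - psi (a *: x + y)) + (a * (psi x - chi x) + (psi y - chi y)).
    by rewrite (charD psiP) (charZ psiP); ring.
  rewrite E; apply: le_lt_trans (cabsD _ _) _.
  have h4 := cabsD (a * (psi x - chi x)) (psi y - chi y).
  rewrite cabsM in h4; rewrite /= cabsB in h1.
  have h5 : cabs a * cabs (psi x - chi x) <= cabs a * d by rewrite ler_wpM2l// ltW.
  by move: h1 h2 h3 h4 h5 de; rewrite /=; lra.
- move=> x y; apply/eqP; rewrite -subr_eq0; apply/eqP/cabs_eq0_small => e e0.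
  have a0 := cabs_ge0 (chi x); have y0 := nrm_ge0 y.
  pose c := 2 + cabs (chi x) + nrm y.
  have c0 : 0 < c by rewrite /c; lra.
  pose d := e / c.
  have d0 : 0 < d by rewrite divr_gt0.
  have de : e = d * c by rewrite divfK// gt_eqF.
  have [psi [psiP [h1 [h2 h3]]]] := filter_ex (filterI FM (filterI (chiP (mul x y) _ d0)
    (filterI (chiP x _ d0) (chiP y _ d0)))).
  have E : chi (mul x y) - (chi x * chi y) =
    (chi (mul x y) - psi (mul x y)) + ((psi x - chi x) * psi y + chi x * (psi y - chi y)).
    by rewrite (charM psiP); ring.
  rewrite E; apply: le_lt_trans (cabsD _ _) _.
  have h4 := cabsD ((psi x - chi x) * psi y) (chi x * (psi y - chi y)).
  rewrite !cabsM in h4; rewrite /= cabsB in h1.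
  have h5 : cabs (chi x) * cabs (psi y - chi y) <= cabs (chi x) * d by rewrite ler_wpM2l// ltW.
  have h6 : cabs (psi x - chi x) * cabs (psi y) <= d * nrm y.
    by apply: ler_pM; rewrite ?cabs_ge0 ?(char_le Alg psiP)// ltW.
  by move: h1 h2 h3 h4 h5 h6 de; rewrite /= /c; lra.
- apply/eqP; rewrite -subr_eq0; apply/eqP/cabs_eq0_small => e e0.
  have [psi [psiP h1]] := filter_ex (filterI FM (chiP one _ e0)).
  by rewrite -(char1 psiP) cabsB.
Qed.

Lemma gclosed_limit B chi : gclosed B -> F B -> is_char chi ->
  (forall f e, 0 < e -> F [set psi | cabs (psi f - chi f) < e]) -> B chi.
Proof.
move=> [BM Bcl] FB chiP lim; apply: contrapT => nB.
have [fs [e [e0 h]]] := Bcl _ chiP nB.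
have : F [set psi | forall f, f \in fs -> cabs (psi f - chi f) < e].
  elim: (fs) => [|g gs IH]; first by apply: filterS filterT => psi _.
  apply: filterS (filterI (lim g _ e0) IH) => psi /= [h1 h2] f.
  by rewrite inE => /orP[/eqP ->//|]; exact: h2.
move=> Fn; have [psi [psi1 psi2]] := filter_ex (filterI FB Fn).
exact: h (BM _ psi1) psi2 psi1.
Qed.
End Ultra.

Lemma gclosed_MA : gclosed MA.
Proof. by split => // chi chiP; case. Qed.

Lemma gclosedI B1 B2 : gclosed B1 -> gclosed B2 -> gclosed (B1 `&` B2).
Proof.
move=> [B1M c1] [B2M c2]; split; first by move=> chi [/B1M].
move=> chi chiP nB; have [b1|nb1] := pselect (B1 chi).
  have [|fs [e [e0 h]]] := c2 _ chiP; first by move=> b2; apply: nB.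
  by exists fs, e; split => // psi psiP hn [_]; exact: h hn.
have [fs [e [e0 h]]] := c1 _ chiP nb1.
by exists fs, e; split => // psi psiP hn [+ _]; exact: h hn.
Qed.

(** By compactness: an ultrafilter finer than the filter of near-maximisers of [f] on [B] converges
    to a maximiser. *)
Lemma gclosed_max B f : gclosed B -> B !=set0 -> exists2 chi, B chi &
  forall psi, B psi -> cabs (psi f) <= cabs (chi f).
Proof.
move=> Bc [chi0 Bchi0]; have BM := Bc.1.
pose S := [set cabs (psi f) | psi in B].
have hS : has_sup S.
  split; first by exists (cabs (chi0 f)); exists chi0.
  by exists (nrm f) => _ [psi /BM psiP <-]; exact: (char_le Alg psiP).
pose F0 : set_system (A -> C) := [set P | exists2 e, 0 < e &
  forall psi, B psi -> sup S - e < cabs (psi f) -> P psi].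
have F0P : ProperFilter F0.
  apply: Build_ProperFilter_ex.
    move=> P [e e0 hP]; have [_ [psi Bpsi <-] h] := sup_adherent e0 hS.
    by exists psi; exact: hP.
  split.
  - by exists 1.
  - move=> P Q [e e0 hP] [d d0 hQ]; exists (Num.min e d); first by rewrite lt_min e0.
    move=> psi Bpsi h; split; [apply: hP => //|apply: hQ => //]; apply: le_lt_trans h.
      by rewrite lerB// ge_min lexx.
    by rewrite lerB// ge_min lexx orbT.
  - by move=> P Q PQ [e e0 hP]; exists e => // psi Bpsi /(hP _ Bpsi)/PQ.
have [G [GU F0G]] := ultraFilterLemma F0P.
have GB : G B by apply: F0G; exists 1.
have [|chi chiP lim] := char_ultra_limit GU; first by apply: filterS GB.
exists chi; first exact: (gclosed_limit GU Bc GB chiP lim).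
move=> psi Bpsi; have hpsi : cabs (psi f) <= sup S by apply: sup_upper_bound => //; exists psi.
apply: le_trans hpsi _; rewrite leNgt; apply/negP => lt.
pose e := (sup S - cabs (chi f)) / 2.
have e0 : 0 < e by rewrite divr_gt0// subr_gt0.
have G1 : G [set psi | sup S - e < cabs (psi f)] by apply: F0G; exists e.
have [psi' [h1 h2]] := filter_ex (filterI G1 (lim f _ e0)).
have := cabs_dist (psi' f) (chi f); move: h1 h2; rewrite /= ler_norml /e; lra.
Qed.

Lemma boundary_MA : is_boundary MA.
Proof.
split => // f; have [chi0 h0] := exists_char.
by have [|chi] := @gclosed_max MA f gclosed_MA; [exists chi0|exists chi].
Qed.

Definition nbhd_compl chi0 (fs : seq A) (e : R) : set (A -> C) :=
  [set psi | is_char psi /\ ~ (forall f, f \in fs -> cabs (psi f - chi0 f) < e)].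

Lemma gclosed_nbhd_compl chi0 fs e : gclosed (nbhd_compl chi0 fs e).
Proof.
split; first by move=> psi [].
move=> chi chiP nW.
have hfs : forall f, f \in fs -> cabs (chi f - chi0 f) < e.
  by apply: contrapT => h; exact: nW.
(* Finitely many strict inequalities leave a common slack [d], the radius of a neighbourhood of
   [chi]. *)
have [d d0 hd] : exists2 d, 0 < d & forall f, f \in fs -> cabs (chi f - chi0 f) + d <= e.
  elim: (fs) hfs => [|g gs IH] h; first by exists 1.
  have [|d d0 hd] := IH; first by move=> f fg; apply: h; rewrite inE fg orbT.
  have hg := h g (mem_head _ _).
  exists (Num.min d (e - cabs (chi g - chi0 g))); first by rewrite lt_min d0 subr_gt0.
  move=> f; rewrite inE => /orP[/eqP ->|/hd h'].
    by rewrite -lerBrDl ge_min lexx orbT.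
  by apply: le_trans h'; rewrite lerD2l ge_min lexx.
exists fs, d; split => // psi psiP h [_]; apply => f fg.
have := hd f fg; have := h f fg; have := cabsD (psi f - chi f) (chi f - chi0 f).
by rewrite subrKA; lra.
Qed.

(* Unlike closed boundaries, unavoidable sets are stable under intersection;
   hence they have a common point at which a given [f] attains its maximum. *)
Definition unavoidable B := gclosed B /\
  forall B', gclosed B' -> is_boundary B' -> is_boundary (B `&` B').

(* If the complement of the neighbourhood fails, some [f] peaks inside it; then
   [f^n * (g - chi0 g)] is small on [B'], hence everywhere, so that the points
   of [B0] where [f] is maximal lie in the neighbourhood. *)
Lemma unavoidable_nbhd_compl chi0 fs e B0 : 0 < e -> gclosed B0 -> is_boundary B0 ->
  (forall psi, is_char psi -> (forall f, f \in fs -> cabs (psi f - chi0 f) < e) -> ~ B0 psi) ->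
  unavoidable (nbhd_compl chi0 fs e).
Proof.
move=> e0 B0c [B0M B0b] B0n; split; first exact: gclosed_nbhd_compl.
move=> B' B'c [B'M B'b]; set W := nbhd_compl _ _ _.
have WBc : gclosed (W `&` B') by apply: gclosedI => //; exact: gclosed_nbhd_compl.
apply: contrapT => nb.
(* [m] is the maximum of [f] over the part of [B'] outside the neighbourhood, or 0 if that part is
   empty; it stays strictly below the global maximum, attained at [s] in [B0]. *)
have [f [s [m [Bs m0 ms smax Wm]]]] : exists f s m, [/\ B0 s, 0 <= m, m < cabs (s f),
    forall psi, is_char psi -> cabs (psi f) <= cabs (s f) &
    forall chi, (W `&` B') chi -> cabs (chi f) <= m].
  have [[chi1 W1]|W0] := pselect ((W `&` B') !=set0); last first.
    have [s Bs smax] := B0b one.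
    exists one, s, 0; split => //.
      by rewrite (char1 (B0M _ Bs)) cabs1.
    by move=> chi Wchi; case: W0; exists chi.
  have [f hf] : exists f, forall chi, (W `&` B') chi ->
      exists2 psi, is_char psi & cabs (chi f) < cabs (psi f).
    apply: contrapT => h; apply: nb; split; first by move=> chi [[]].
    move=> f; apply: contrapT => h'; apply: h; exists f => chi Wchi.
    apply: contrapT => h''; apply: h'; exists chi => // psi psiP.
    by rewrite leNgt; apply/negP => lt; apply: h''; exists psi.
  have [s Bs smax] := B0b f.
  have [chi Wchi chimax] := gclosed_max f WBc (ex_intro _ chi1 W1).
  exists f, s, (cabs (chi f)); split => //; first exact: cabs_ge0.
  by have [psi psiP lt] := hf _ Wchi; apply: lt_le_trans lt (smax _ psiP).
have sP := B0M _ Bs.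
apply: (B0n s sP _ Bs) => g gfs.
have mu0 : 0 < cabs (s f) by apply: le_lt_trans ms.
pose h := g - chi0 g *: one.
have hE psi : is_char psi -> psi h = psi g - chi0 g.
  by move=> psiP; rewrite (charB psiP) (charZ psiP) (char1 psiP) mulr1.
have [|n hn] := @exists_expr_small R (m / cabs (s f)) (nrm h) e _ (nrm_ge0 h) e0.
  by rewrite divr_ge0 ?cabs_ge0//= ltr_pdivrMr// mul1r.
have mun : 0 < cabs (s f) ^+ n by rewrite exprn_gt0.
have {}hn : m ^+ n * nrm h < e * cabs (s f) ^+ n.
  by rewrite -ltr_pdivrMr// mulrAC -expr_div_n mulrC.
have [chi Bchi chimax] := B'b (mul (apow mul one f n) h).
have chiP := B'M _ Bchi.
have := chimax s sP.
rewrite (charM sP) (charM chiP) !(charX sP, charX chiP) !cabsM !cabsX (hE _ sP) (hE _ chiP).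
move=> le; rewrite -(ltr_pM2l mun); apply: le_lt_trans le _.
(* On [W] the power of [f] is small; off [W] the point [chi] lies in the neighbourhood, where [h] is
   less than [e]. *)
have [Wchi|nW] := pselect (W chi).
  rewrite [ltRHS]mulrC; apply: le_lt_trans hn.
  apply: ler_pM; rewrite ?exprn_ge0 ?cabs_ge0//.
    by rewrite lerXn2r ?nnegrE ?cabs_ge0// Wm.
  by rewrite -(hE _ chiP) (char_le Alg chiP).
have lt : cabs (chi g - chi0 g) < e.
  have : forall f, f \in fs -> cabs (chi f - chi0 f) < e; last exact.
  by apply: contrapT => hh; apply: nW.
apply: (@le_lt_trans _ _ (cabs (s f) ^+ n * cabs (chi g - chi0 g))).
  rewrite ler_wpM2r ?cabs_ge0// lerXn2r ?nnegrE ?cabs_ge0//.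
  exact: smax.
by rewrite ltr_pM2l.
Qed.

(** Shilov's theorem. The maximum points of [f] on unavoidable sets generate a proper filter; let
    [chi] be the limit of a finer ultrafilter. If a closed boundary [B] missed [chi], some
    neighbourhood of [chi] would miss [B]. Its complement would be unavoidable and closed, so it
    would contain [chi], which is absurd. *)
Lemma boundary_shilov : is_boundary (shilov mul one).
Proof.
split; first by move=> chi [].
move=> f; have [s0 s0P s0max] := boundary_MA.2 f.
pose F0 : set_system (A -> C) := [set P | exists2 B, unavoidable B &
  forall psi, B psi -> cabs (psi f) = cabs (s0 f) -> P psi].
have F0P : ProperFilter F0.
  apply: Build_ProperFilter_ex.
    move=> P [B [Bc Bu] hP].
    have [_ /(_ f)[chi [Bchi chiP] chimax]] := Bu _ gclosed_MA boundary_MA.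
    exists chi; apply: hP => //; apply/eqP; rewrite eq_le.
    by rewrite s0max// chimax.
  split.
  - exists MA => //; split; first exact: gclosed_MA.
    by move=> B' _ B'b; rewrite setIidr//; exact: B'b.1.
  - move=> P Q [B1 [B1c B1u] hP] [B2 [B2c B2u] hQ]; exists (B1 `&` B2).
      split; first exact: gclosedI.
      move=> B' B'c B'b; rewrite -setIA; apply: B1u; last exact: B2u.
      exact: gclosedI.
    by move=> psi [b1 b2] h; split; [exact: hP|exact: hQ].
  - by move=> P Q PQ [B Bu hP]; exists B => // psi Bpsi /(hP _ Bpsi)/PQ.
have [G [GU F0G]] := ultraFilterLemma F0P.
have Gu B : unavoidable B -> G B by move=> Bu; apply: F0G; exists B.
have MAu : unavoidable MA.
  split; first exact: gclosed_MA.
  by move=> B' _ B'b; rewrite setIidr//; exact: B'b.1.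
have [|chi chiP lim] := char_ultra_limit GU; first exact: Gu.
exists chi; last first.
  move=> psi psiP; apply: le_trans (s0max _ psiP) _; rewrite leNgt; apply/negP => lt.
  have d0 : 0 < cabs (s0 f) - cabs (chi f) by rewrite subr_gt0.
  have G1 : G [set psi | cabs (psi f) = cabs (s0 f)] by apply: F0G; exists MA.
  have [psi' [h1 h2]] := filter_ex (filterI G1 (lim f _ d0)).
  have := cabs_dist (psi' f) (chi f); move: h1 h2; rewrite /= ler_norml => ->; lra.
split => // B Bc Bb; apply: contrapT => nB.
have [fs [e [e0 h]]] := Bc.2 _ chiP nB.
have Wu := unavoidable_nbhd_compl e0 Bc Bb h.
have [_] := gclosed_limit GU Wu.1 (Gu _ Wu) chiP lim; apply => g _.
by rewrite subrr cabs0.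
Qed.

End ShilovBoundary.

(** * Weighted automorphisms *)

Section IntIteration.
Variables (X : Type) (f fi : X -> X).
Hypotheses (fK : cancel f fi) (fiK : cancel fi f).

Definition ziter (n : int) : X -> X :=
  match n with Posz k => iter k f | Negz k => iter k.+1 fi end.

Lemma ziterS n x : ziter (n + 1) x = f (ziter n x).
Proof.
case: n => [k|[|k]].
- by rewrite (_ : k%:Z + 1 = k.+1%:Z)//; lia.
- by rewrite (_ : Negz 0 + 1 = 0)//= fiK.
- by rewrite (_ : Negz k.+1 + 1 = Negz k)/= ?fiK//; lia.
Qed.

Lemma ziterP n x : ziter (n - 1) x = fi (ziter n x).
Proof. by rewrite -{2}(subrK 1 n) ziterS fK. Qed.

Lemma ziter_ind (P : int -> Prop) : P 0 -> (forall n, P n -> P (n + 1)) ->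
  (forall n, P n -> P (n - 1)) -> forall n, P n.
Proof.
move=> P0 PS PP; elim/int_rect => [//|n|n] h.
  by rewrite -addn1 PoszD; exact: PS.
by rewrite -addn1 PoszD opprD; exact: PP.
Qed.

Lemma ziterD m n x : ziter (m + n) x = ziter m (ziter n x).
Proof.
elim/ziter_ind: m => [|m IH|m IH]; first by rewrite add0r.
  by rewrite addrAC !ziterS IH.
by rewrite addrAC !ziterP IH.
Qed.

Lemma ziterSr n x : ziter (n + 1) x = ziter n (f x).
Proof. by rewrite ziterD. Qed.

End IntIteration.

Lemma bounded_sums_of_series (R : realType) (a : nat -> R) : (forall n, 0 <= a n) ->
  (\sum_(0 <= k <oo) (a k)%:E < +oo)%E ->
  exists s, forall N, \sum_(0 <= n < N) a n <= s.
Proof.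
move=> a0 h.
have f : (\sum_(0 <= k <oo) (a k)%:E)%E \is a fin_num.
  by rewrite ge0_fin_numE// nneseries_ge0// => n _ _; rewrite lee_fin.
exists (fine (\sum_(0 <= k <oo) (a k)%:E)%E) => N.
rewrite -lee_fin fineK// -sumEFin.
by apply: nneseries_lim_ge => n _ _; rewrite lee_fin.
Qed.

(** * The cocycle of the weighted automorphism and the norms of T-check *)

Section WeightedAutomorphism.
Variable R : realType.
Local Notation C := (complex R).
Variable A : completeNormedModType C.
Variables (mul : A -> A -> A) (one : A) (U Ui : A -> A) (w v : A).
Hypothesis Alg : is_comBanachAlg mul one.
Hypothesis Ass : semisimple mul one.
Hypothesis Ulin : forall (a : C) x y, U (a *: x + y) = a *: U x + U y.
Hypothesis UM : forall x y, U (mul x y) = mul (U x) (U y).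
Hypothesis U1 : U one = one.
Hypothesis UK : cancel U Ui.
Hypothesis UiK : cancel Ui U.
Hypothesis wv : mul w v = one.
Local Notation is_char := (is_char mul one).
Local Notation shilov := (shilov mul one).

Let UiM x y : Ui (mul x y) = mul (Ui x) (Ui y).
Proof. by apply: (can_inj UK); rewrite UM !UiK. Qed.
Let Ui1 : Ui one = one. Proof. by rewrite -{1}U1 UK. Qed.
Let Uilin (a : C) x y : Ui (a *: x + y) = a *: Ui x + Ui y.
Proof. by apply: (can_inj UK); rewrite Ulin !UiK. Qed.

Let T := Top mul U w.
Let Ti f := Ui (mul v f).

Let TK : cancel T Ti.
Proof.
move=> f; rewrite /T /Ti /Top (cba_mulA Alg) (cba_mulC Alg v) wv (cba_mul1 Alg).
exact: UK.
Qed.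

Let TiK : cancel Ti T.
Proof. by move=> f; rewrite /T /Ti /Top UiK (cba_mulA Alg) wv (cba_mul1 Alg). Qed.

Let Tz := ziter T Ti.
Let Uz := ziter U Ui.

Lemma char_U chi : is_char chi -> is_char (chi \o U).
Proof.
move=> [h1 h2 h3]; split => [a x y|x y|] /=; first by rewrite Ulin h1.
  by rewrite UM h2.
by rewrite U1.
Qed.

Lemma char_Ui chi : is_char chi -> is_char (chi \o Ui).
Proof.
move=> [h1 h2 h3]; split => [a x y|x y|] /=; first by rewrite Uilin h1.
  by rewrite UiM h2.
by rewrite Ui1.
Qed.

Let char_Uz chi n : is_char chi -> is_char (chi \o Uz n).
Proof.
move=> chiP; elim/ziter_ind: n chi chiP => [//|n IH|n IH] chi chiP.
  rewrite (_ : chi \o _ = (chi \o U) \o Uz n); first by apply: IH; exact: char_U.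
  by apply/funext => x; rewrite /comp /Uz (ziterS UiK).
rewrite (_ : chi \o _ = (chi \o Ui) \o Uz n); first by apply: IH; exact: char_Ui.
by apply/funext => x; rewrite /comp /Uz (ziterP UK UiK).
Qed.

(** The weights multiply along the orbit, and their product is [Tz n one]. All estimates on powers
    of [T] thus reduce to the values of this one element at characters. *)
Let Tz_factor n f : Tz n f = mul (Tz n one) (Uz n f).
Proof.
elim/ziter_ind: n => [|n IH|n IH]; first by rewrite /= (cba_mul1 Alg).
  by rewrite /Tz /Uz !ziterS// -/Tz -/Uz IH /T /Top UM (cba_mulA Alg).
by rewrite /Tz /Uz !ziterP// -/Tz -/Uz IH /Ti -UiM -(cba_mulA Alg).
Qed.

Let char_Tz chi n f : is_char chi -> chi (Tz n f) = chi (Tz n one) * chi (Uz n f).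
Proof. by move=> chiP; rewrite Tz_factor (charM chiP). Qed.

(** For negative powers, dividing by [gcheck w] at [phiinv chi] amounts to multiplying by
    [chi (Ui v)], because [chi (Ui w) * chi (Ui v) = 1]. *)
Lemma Tcheck_powE chi n g : is_char chi ->
  Tcheck_pow U Ui w n g chi = chi (Tz n one) * g (chi \o Uz n).
Proof.
case: n => k chiP /=.
  elim: k chi chiP => [|k IH] chi chiP /=; first by rewrite (char1 chiP) mul1r.
  rewrite /Tcheck /gcheck /phi IH; last exact: char_U.
  by rewrite mulrA -(charM chiP).
rewrite -!iterS; elim: k.+1 chi chiP => [|m IH] chi chiP /=.
  by rewrite (char1 chiP) mul1r.
rewrite /Tcheckinv /gcheck /phiinv IH; last exact: char_Ui.
rewrite [RHS](_ : _ = chi (Ui v) * chi (Ui (iter m Ti one)) *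
  g ((chi \o Ui) \o iter m Ui)); last first.
  by rewrite /Ti UiM (charM chiP).
have wn : chi (Ui w) * chi (Ui v) = 1.
  by rewrite -(charM chiP) -UiM wv Ui1 (char1 chiP).
have w0 : chi (Ui w) != 0.
  by apply/eqP => h; move: wn; rewrite h mul0r => /eqP; rewrite eq_sym oner_eq0.
apply: (mulfI w0); rewrite /= [LHS]mulrC divfK// mulrA mulrA wn mul1r.
by [].
Qed.

(* Pulling a closed boundary back along [chi |-> chi \o V] yields a closed boundary. *)
Lemma shilov_comp (V Vi : A -> A) : cancel V Vi -> cancel Vi V ->
  (forall chi, is_char chi -> is_char (chi \o V)) ->
  (forall chi, is_char chi -> is_char (chi \o Vi)) ->
  forall t, shilov t -> shilov (t \o V).
Proof.
move=> VK ViK cV cVi t [tP th]; split; first exact: cV.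
move=> B [BM Bc] [_ Bb].
have compVi chi : chi \o V \o Vi = chi by apply/funext => x /=; rewrite ViK.
have compV chi : chi \o Vi \o V = chi by apply/funext => x /=; rewrite VK.
suff : [set chi : A -> C | B (chi \o V)] t by []; apply: th.
  split=> [chi /= /BM/cVi|]; first by rewrite compVi.
  move=> chi chiP /= nB; have [fs [e [e0 h]]] := Bc _ (cV _ chiP) nB.
  exists (map V fs), e; split => // psi psiP hn.
  by apply: (h _ (cV _ psiP)) => f ff /=; apply: hn; rewrite map_f.
split=> [chi /= /BM/cVi|]; first by rewrite compVi.
move=> f; have [chi Bchi chimax] := Bb (Vi f).
exists (chi \o Vi); first by rewrite /= compV.
by move=> psi psiP; have := chimax _ (cV _ psiP); rewrite /= ViK.
Qed.

Let shilov_Uz t n : shilov t -> shilov (t \o Uz n).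
Proof.
have VK : cancel (Uz n) (Uz (- n)).
  by move=> x; rewrite /Uz -(ziterD UK UiK) addNr.
have ViK : cancel (Uz (- n)) (Uz n).
  by move=> x; rewrite /Uz -(ziterD UK UiK) addrN.
by apply: (shilov_comp VK ViK) => chi; exact: char_Uz.
Qed.

(** The constant function 1 is extremal: composition with [Uz n] preserves the Shilov boundary, so a
    function of norm at most 1 cannot increase the weight. *)
Lemma opnorm_TcheckE n (r : R) : 
  (exists2 t, shilov t & cabs (t (Tz n one)) = r) ->
  (forall psi, is_char psi -> cabs (psi (Tz n one)) <= r) ->
  opnorm_Tcheck mul one U Ui w n = r%:E.
Proof.
move=> [t ts tr] hr; apply/eqP; rewrite eq_le; apply/andP; split.
  apply: ge_ereal_sup => _ [g [_ g1] <-].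
  apply: ge_ereal_sup => _ [s ss <-].
  rewrite lee_fin Tcheck_powE; last by case: ss.
  have gs : cabs (g (s \o Uz n)) <= 1.
    rewrite -lee_fin; apply: le_trans g1; apply: ereal_sup_ubound.
    by exists (s \o Uz n) => //; exact: shilov_Uz.
  rewrite cabsM (le_trans _ (hr s _))//; last by case: ss.
  by rewrite ler_piMr ?cabs_ge0.
have h1 : (supn mul one (fun=> 1%R) <= 1)%E.
  by apply: ge_ereal_sup => _ [s _ <-]; rewrite lee_fin cabs1.
have h2 : Acheck mul one (fun=> 1).
  move=> e e0; exists one => s [sP _].
  by rewrite /gcheck (char1 sP) subrr cabs0.
apply: le_trans (ereal_sup_ubound _); last first.
  by exists (fun=> 1); [split; [exact: h2|exact: h1]|reflexivity].
apply: ereal_sup_ubound; exists t => //.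
by rewrite Tcheck_powE ?mulr1 ?tr//; case: ts.
Qed.

(** [rho n] is the maximum modulus of [Tz n one], attained on the Shilov boundary. The factorisation
    of [Tz] makes it submultiplicative, and positive because no character vanishes at [Tz n one]. *)
Lemma exists_weight_norms : exists rho : int -> R,
  [/\ forall n, 0 < rho n, rho 0 = 1, forall m n, rho (m + n) <= rho m * rho n,
      forall n, opnorm_Tcheck mul one U Ui w n = (rho n)%:E &
      forall n psi, is_char psi -> cabs (psi (Tz n one)) <= rho n].
Proof.
have h n : exists r, (exists2 t, shilov t & cabs (t (Tz n one)) = r) /\
    (forall psi, is_char psi -> cabs (psi (Tz n one)) <= r).
  have [t ts tmax] := (boundary_shilov Alg Ass).2 (Tz n one).
  by exists (cabs (t (Tz n one))); split => //; exists t.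
have [rho rhoP] := choice h; exists rho.
have rhole n psi : is_char psi -> cabs (psi (Tz n one)) <= rho n by move: psi; case: (rhoP n).
split => //.
- move=> n; have [[t [tP _] <-] _] := rhoP n.
  rewrite cabs_gt0; apply/eqP => h0.
  have := char_Tz n (Tz (- n) one) tP.
  rewrite h0 mul0r /Tz -(ziterD TK TiK) subrr /= (char1 tP) => /eqP.
  by rewrite oner_eq0.
- by have [[t [tP _] <-] _] := rhoP 0; rewrite /= (char1 tP) cabs1.
- move=> m n; have [[t [tP _] <-] _] := rhoP (m + n).
  rewrite /Tz (ziterD TK TiK) -/Tz char_Tz// cabsM.
  apply: ler_pM; rewrite ?cabs_ge0 ?rhole//.
  by apply: (rhole n (t \o Uz m)); exact: char_Uz.
- by move=> n; have [h1 h2] := rhoP n; exact: opnorm_TcheckE.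
Qed.

(** * Functions peaking at aperiodic points *)

Hypothesis Uaper : forall n : nat, (0 < n)%N -> iter n U <> id.

Lemma exists_aperiodic N : exists2 t, shilov t &
  forall n, (0 < n <= N)%N -> exists x, t (iter n U x) <> t x.
Proof.
apply: contrapT => h.
have per t : shilov t -> exists2 n, (0 < n <= N)%N & forall x, t (iter n U x) = t x.
  move=> ts; apply: contrapT => h'; apply: h; exists t => // n nN.
  apply: contrapT => h''; apply: h'; exists n => // x.
  by apply: contrapT => hx; apply: h''; exists x.
apply: (Uaper (fact_gt0 N)); apply/funext => f /=.
apply/eqP; rewrite -subr_eq0; apply/eqP; apply: Ass => chi chiP.
have [t ts tmax] := (boundary_shilov Alg Ass).2 (iter N`! U f - f).
have t0 : t (iter N`! U f - f) = 0.
  have [n /andP[n0 nN] tn] := per t ts.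
  have tP : is_char t by case: ts.
  have /dvdnP[k ->] : (n %| N`!)%N by apply: dvdn_fact; rewrite n0.
  rewrite (charB tP); apply/eqP; rewrite subr_eq0; apply/eqP.
  by elim: k => [//|k IH]; rewrite mulSn iterD tn.
apply/eqP; rewrite -cabs_eq0 eq_le cabs_ge0 andbT.
by have := tmax _ chiP; rewrite t0 cabs0.
Qed.

(* In a small neighbourhood of an aperiodic point no two of the first [N]
   iterates meet, and by minimality of the Shilov boundary some [f] peaks there. *)
Lemma exists_peak N : exists t f, [/\ shilov t, t f != 0,
  forall psi, is_char psi -> cabs (psi f) <= cabs (t f) &
  forall n : int, (0 < absz n <= N)%N -> cabs (t (Uz n f)) < cabs (t f)].
Proof.
have [t ts aper] := exists_aperiodic N.
have tP : is_char t by case: ts.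
(* Both [x] and [iter n U x] are listed: for [s] near [t], the value [s (iter n U x)] is close to
   [t (iter n U x)], and it would be close to [t x] as well if [s \o iter n U] were also near
   [t]. *)
have [fs [e [e0 sep]]] : exists (fs : seq A) (e : R), 0 < e /\ forall n, (0 < n <= N)%N ->
    exists x, [/\ x \in fs, iter n U x \in fs & e + e <= cabs (t (iter n U x) - t x)].
  elim: N aper => [|N IH] aper; first by exists [::], 1; split => // n; lia.
  have [n nN|fs [e [e0 he]]] := IH; first by apply: aper; lia.
  have [|x hx] := aper N.+1; first by rewrite leqnn.
  pose d := cabs (t (iter N.+1 U x) - t x).
  have d0 : 0 < d by rewrite cabs_gt0 subr_eq0; exact/eqP.
  exists (x :: iter N.+1 U x :: fs), (Num.min e (d / 2)); split.
    by rewrite lt_min e0 divr_gt0.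
  have m1 : Num.min e (d / 2) <= e by rewrite ge_min lexx.
  have m2 : Num.min e (d / 2) <= d / 2 by rewrite ge_min lexx orbT.
  move=> n /andP[n0]; rewrite leq_eqVlt => /orP[/eqP ->|nN].
    exists x; split; rewrite ?inE ?eqxx ?orbT//.
    by rewrite -/d; move: m2; lra.
  have [|y [y1 y2 y3]] := he n; first by rewrite n0.
  exists y; split; rewrite ?inE ?y1 ?y2 ?orbT//.
  by move: m1 y3; lra.
pose W := nbhd_compl mul one t fs e.
have nWt : ~ W t by move=> [_]; apply => f _; rewrite subrr cabs0.
have notW s : is_char s -> ~ W s -> forall f, f \in fs -> cabs (s f - t f) < e.
  by move=> sP nW; apply: contrapT => h; apply: nW.
have disj s n : is_char s -> (0 < n <= N)%N -> ~ W s -> ~ W (s \o iter n U) -> False.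
  move=> sP nN nW1 nW2; have [x [x1 x2 x3]] := sep n nN.
  have sP' : is_char (s \o iter n U) by exact: (char_Uz n%:Z).
  have h1 := notW _ sP nW1 _ x2; have h2 := notW _ sP' nW2 _ x1.
  have := cabsD (t (iter n U x) - s (iter n U x)) (s (iter n U x) - t x).
  by rewrite subrKA; rewrite cabsB in h1; move: h1 h2 x3; rewrite /=; lra.
(* [W] is closed and misses the point [t] of the Shilov boundary, so it is not a boundary. *)
have [f hf] : exists f, forall chi, W chi ->
    exists2 psi, is_char psi & cabs (chi f) < cabs (psi f).
  apply: contrapT => h; apply: nWt; case: ts => _; apply.
    exact: gclosed_nbhd_compl.
  split; first by move=> chi [].
  move=> f; apply: contrapT => h'; apply: h; exists f => chi Wchi.
  apply: contrapT => h''; apply: h'; exists chi => // psi psiP.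
  by rewrite leNgt; apply/negP => lt; apply: h''; exists psi.
have [s ss smax] := (boundary_shilov Alg Ass).2 f.
have sP : is_char s by case: ss.
have Wlt chi : W chi -> cabs (chi f) < cabs (s f).
  by move=> /hf[psi psiP lt]; apply: lt_le_trans lt (smax _ psiP).
have nWs : ~ W s by move=> /Wlt; rewrite ltxx.
have [s0|s0] := eqVneq (s f) 0.
  (* then [W] is empty, so [one] will do *)
  have nW chi : ~ W chi by move=> /Wlt; rewrite s0 cabs0 ltNge cabs_ge0.
  exists s, one; split=> //.
  - by rewrite (char1 sP) oner_eq0.
  - by move=> psi psiP; rewrite (char1 sP) (char1 psiP).
  - move=> n nN; exfalso.
    by apply: (@disj s (absz n) sP nN); exact: nW.
exists s, f; split => // n nN; apply: (Wlt (s \o Uz n)); apply: contrapT => nW.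
case: n nN nW => k /= kN nW; first exact: (disj s k sP kN nWs nW).
(* For a negative index the roles are exchanged: [s] is the forward iterate of
   [s \o Uz (Negz k)]. *)
apply: (disj (s \o Uz (Negz k)) k.+1) => //; first exact: char_Uz.
rewrite (_ : _ \o _ = s)//; apply/funext => x /=.
rewrite -[LHS]/(s (Uz (Negz k) (Uz k.+1%:Z x))) /Uz -(ziterD UK UiK).
by rewrite NegzE addNr.
Qed.

(** At the finitely many iterates the peaking function, divided by its maximum, is bounded by some
    [q < 1]; a high power brings this below [e] and keeps the value 1 at [t]. *)
Lemma exists_peak_normalized N (e : R) : 0 < e -> exists t f, [/\ shilov t, t f = 1,
  forall psi, is_char psi -> cabs (psi f) <= 1 &
  forall n : int, (0 < absz n <= N)%N -> cabs (t (Uz n f)) <= e].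
Proof.
move=> e0; have [t [f [ts tf fmax fn]]] := exists_peak N.
have tP : is_char t by case: ts.
have mu0 : 0 < cabs (t f) by rewrite cabs_gt0.
have [q /andP[q0 q1] hq] : exists2 q, 0 <= q < 1 &
    forall n : int, (0 < absz n <= N)%N -> cabs (t (Uz n f)) <= q * cabs (t f).
  elim: N fn => [|N IH] fn; first by exists 0; rewrite ?lexx ?ltr01// => n; lia.
  have [n nN|q /andP[q0 q1] hq] := IH; first by apply: fn; lia.
  pose q' n := cabs (t (Uz n f)) / cabs (t f).
  have q'0 n : 0 <= q' n by rewrite divr_ge0 ?cabs_ge0.
  have q'1 n : (absz n = N.+1) -> q' n < 1.
    by move=> nN; rewrite ltr_pdivrMr// mul1r fn// nN leqnn.
  exists (Num.max q (Num.max (q' N.+1%:Z) (q' (Negz N)))).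
    by rewrite le_max q0/= !gt_max q1 !q'1.
  move=> n /andP[n0 nN].
  rewrite -ler_pdivrMr// -/(q' n) !le_max.
  have [nN'|nN'] := leqP (absz n) N.
    by rewrite /q' ler_pdivrMr// hq// n0.
  have [->|->] : n = N.+1%:Z \/ n = Negz N by lia.
    by rewrite lexx !orbT.
  by rewrite lexx !orbT.
have [|p hp] := @exists_expr_small R q 1 e _ ler01 e0; first by rewrite q0.
pose f1 := (t f)^-1 *: f.
have f1E psi : is_char psi -> psi (apow mul one f1 p) = ((t f)^-1 * psi f) ^+ p.
  by move=> psiP; rewrite (charX psiP) (charZ psiP).
exists t, (apow mul one f1 p); split => //.
- by rewrite f1E// mulVf// expr1n.
- move=> psi psiP; rewrite f1E// cabsX exprn_ile1 ?cabs_ge0//.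
  by rewrite cabsM cabsV mulrC ler_pdivrMr// mul1r fmax.
- move=> n nN; have := f1E _ (char_Uz n tP); rewrite /= => ->.
  apply: le_trans (ltW hp); rewrite mul1r cabsX lerXn2r ?nnegrE ?cabs_ge0//.
  by rewrite cabsM cabsV mulrC ler_pdivrMr// hq.
Qed.

(** * Contradiction from a bounded resolvent *)

Hypothesis Tsum : int_summable (fun n : int =>
    `|ln (fine (opnorm_Tcheck mul one U Ui w n))| / (1 + (n%:~R : R) ^+ 2)).

Lemma resolvent_absurd (lam : C) (S : A -> A) (M : R) : cabs lam = 1 -> 0 < M ->
  (forall x, nrm (S x) <= M * nrm x) ->
  cancel S (fun x => T x - lam *: x) -> False.
Proof.
move=> lam1 M0 SM SK.
have [rho [rho_gt0 rho0 rhoD rhoE rhole]] := exists_weight_norms.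
have lam0 : lam != 0 by rewrite -cabs_gt0 lam1.
have cabsz n : cabs (lam ^ n) = 1.
  by case: n => k; rewrite /exprz ?cabsV cabsX lam1 expr1n ?invr1.
have [s [sp sn]] : exists s, 
  (forall N, \sum_(0 <= n < N) `|ln (rho n%:Z)| / (1 + (n%:Z%:~R) ^+ 2) <= s) /\
  (forall N, \sum_(0 <= n < N) `|ln (rho (Negz n))| / (1 + ((Negz n)%:~R) ^+ 2) <= s).
  have ge0 (n : int) : 0 <= `|ln (rho n)| / (1 + (n%:~R : R) ^+ 2).
    by rewrite divr_ge0// addr_ge0// sqr_ge0.
  case: Tsum; under eq_eseriesr do rewrite rhoE /=.
  move=> /(bounded_sums_of_series (fun n => ge0 n%:Z))[s1 h1].
  under eq_eseriesr do rewrite rhoE /=.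
  move=> /(bounded_sums_of_series (fun n => ge0 (Negz n)))[s2 h2].
  exists (Num.max s1 s2); split => N; rewrite le_max ?h1// h2 orbT//.
have [N0 [e0 e0_gt0 core]] := divisible_seq_lt1 rho_gt0 rho0 rhoD sp sn M0.
have [t [f [ts tf1 fle fsmall]]] := exists_peak_normalized N0 e0_gt0.
have tP : is_char t by case: ts.
pose b k n := t (Tz n (iter k S f)).
have brec k n : b k n = b k.+1 (n + 1) - lam * b k.+1 n.
  rewrite /b /Tz (ziterSr TK TiK) -/Tz iterS -{1}[iter k S f]SK.
  set g := S _.
  rewrite (char_Tz n (T g - lam *: g) tP) (char_Tz n (T g) tP) (char_Tz n g tP).
  have := charB (char_Uz n tP) (T g) (lam *: g).
  rewrite (charZ (char_Uz n tP)) /= => ->; ring.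
have nS k : nrm (iter k S f) <= M ^+ k * nrm f.
  elim: k => [|k IH]; first by rewrite expr0 mul1r.
  by rewrite exprS -mulrA (le_trans (SM _))// ler_wpM2l// ltW.
have babs k n : cabs (b k n) <= rho n * cabs (t (Uz n (iter k S f))).
  by rewrite /b (char_Tz n _ tP) cabsM ler_wpM2r ?cabs_ge0// rhole.
(* The twist by [lam ^ (k - n)] turns [brec] into a plain difference without changing moduli. Real
   parts are taken because the pairing is set up for real sequences. *)
pose be k n := complex.Re (lam ^ (k%:Z - n) * b k n).
have beb k n : `|be k n| <= cabs (b k n).
  by apply: le_trans (normRe_le_cabs _) _; rewrite cabsM cabsz mul1r.
suff : `|be 0%N 0| < 1.
  by rewrite /be subrr expr0z mul1r /b /= tf1 /= normr1 ltxx.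
apply: (core be (nrm f)).
- move=> k n; rewrite /be -raddfB/=; congr (complex.Re _).
  rewrite (_ : k.+1%:Z - (n + 1) = k%:Z - n); last by lia.
  rewrite (_ : k.+1%:Z - n = (k%:Z - n) + 1); last by lia.
  by rewrite (expfzDr (k%:Z - n) 1 lam0) expr1z brec; ring.
- move=> k n; apply: le_trans (beb k n) _; apply: le_trans (babs k n) _.
  rewrite mulrC ler_wpM2r ?(ltW (rho_gt0 n))//.
  rewrite mulrC; apply: le_trans (nS k).
  exact: (char_le Alg (char_Uz n tP)).
- move=> n; apply: le_trans (beb _ n) _; apply: le_trans (babs _ n) _.
  by rewrite ler_piMr ?(ltW (rho_gt0 n))//; exact: (fle _ (char_Uz n tP)).
- move=> n nN; apply: le_trans (beb _ n) _; apply: le_trans (babs _ n) _.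
  by rewrite mulrC ler_wpM2r ?(ltW (rho_gt0 n))// fsmall.
Qed.

End WeightedAutomorphism.

Lemma continuous_linear_nrm (R : realType) (A : completeNormedModType (complex R))
    (S : A -> A) : (forall (a : complex R) x y, S (a *: x + y) = a *: S x + S y) ->
  continuous S -> exists2 M : R, 0 < M & forall x, nrm (S x) <= M * nrm x.
Proof.
move=> Slin Sc.
pose S' : {linear A -> A} := HB.pack S (GRing.isLinear.Build _ _ _ _ S Slin).
have := continuous_linear_bounded 0 (f := S') (Sc 0).
move=> /linear_boundedP/pinfty_ex_gt0[r r0 h].
have rR : (complex.Re r)%:C%C = r by rewrite RRe_real// gtr0_real.
exists (complex.Re r); first by rewrite -ltcR rR.
by move=> x; rewrite -lecR rmorphM/= rR !nrmE; exact: h.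
Qed.

Unset Implicit Arguments.

Theorem theorem2 (R : realType) (A : completeNormedModType (complex R))
    (mul : A -> A -> A) (one : A) (U Ui : A -> A) (w : A) :
  is_comBanachAlg mul one ->
  semisimple mul one ->
  (* U is an (algebra) automorphism of A with inverse Ui *)
  (forall (a : complex R) x y, U (a *: x + y) = a *: U x + U y) ->
  (forall x y, U (mul x y) = mul (U x) (U y)) ->
  U one = one ->
  cancel U Ui -> cancel Ui U ->
  (* w is invertible in A *)
  (exists v, mul w v = one) ->
  (* (i) U^n <> I for all n >= 1 *)
  (forall n : nat, (0 < n)%N -> iter n U <> id) ->
  (* (ii) sum_{n in Z} |ln ||T-check^n||| / (1 + n^2) < oo *)
  int_summable (fun n : int =>
    `|ln (fine (opnorm_Tcheck mul one U Ui w n))| / (1 + (n%:~R : R) ^+ 2)) ->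
  (* conclusion: the unit circle is contained in sigma(T) *)
  forall lam : complex R, `|lam| = 1 ->
    spectrum (Top mul U w) lam.
Proof.
move=> Alg Ass Ulin UM U1 UK UiK [v wv] Uaper Tsum lam lam1 [S [Slin Sc _ SK]].
have [M M0 SM] := continuous_linear_nrm Slin Sc.
apply: (resolvent_absurd Alg Ass Ulin UM U1 UK UiK wv Uaper Tsum _ M0 SM SK).
by rewrite /cabs lam1.
Qed.
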